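(* Let $\phi:\Gamma'\to\Gamma$ be the universal cover of a compact metric graph $\Gamma$ with $g(\Gamma) \geq 2$. For $x \in \Gamma'$, let $\mu_x$ be the probability measure on the space of ends $\partial \Gamma'$ defined in the context. Then: (a) Let $e$ be an edge in $\Gamma$ (i.e. an edge of a model of $\Gamma$) and let $e'$ be a lift of $e$ to $\Gamma'$, with endpoints $e'^-$ and $e'^+$. Then $$\mu_{\phi, \mathrm{can}} (e) = \frac{1}{2} \left|\mu_{e'^+} - \mu_{e'^-} \right| (\partial \Gamma').$$ (b) For any line segment $e'$ in $\Gamma'$ and $x \in e'$ we have $$\mu_{\mathrm{can}}^{\Gamma'}|_{e'} = \left(\frac{1}{2}\left|\frac{d}{dx}\mu_x\right|(\partial \Gamma')\right)dx .$$ Here $\frac{d}{dx}\mu_x$ denotes the signed measure $\lim_{\delta\rightarrow 0}\frac{1}{\delta}(\mu_{x+\delta \mathbf{v}}-\mu_x)$, where $\mathbf{v}$ is any unit tangent direction at $x$ (along $e'$), and $|\mu|$ denotes the total variation of a signed measure $\mu$.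
   Context: Metric graphs. A metric graph is a connected metric space $\Gamma$ such that, for some fixed $\epsilon>0$, every point has a neighborhood isometric to a star-shaped set $S(n,r)=\{te^{2\pi i k/n} : 0\le t<r,\ k\in\mathbb{Z}\}\subset\mathbb{C}$ of finite valence $n$ and radius $r\geq\epsilon$, endowed with the path metric. $\Gamma$ need not be compact. A vertex set is a discrete subset $V\subset\Gamma$ containing all points of valence $\neq 2$ such that every connected component of $\Gamma\setminus V$ is isometric (in its path metric) to a bounded open interval. It determines a model $G$: the weighted graph with vertex set $V(G)=V$, edge set $E(G)$ the set of components of $\Gamma\setminus V$, and $\ell(e)>0$ the length of the edge $e$ (loops and multiple edges are allowed). $\mathbb{E}(G)$ is the set of oriented edges; each edge has two orientations $e,\bar e\in\mathbb{E}(G)$; $e^-$ and $e^+$ are the initial and terminal vertices of $e$. An orientation $\mathcal{O}\subset\mathbb{E}(G)$ selects one orientation of each edge. The genus $g(\Gamma)$ is the dimension of the first homology of $\Gamma$. A line segment in $\Gamma'$ means an edge (open interval) of some model of $\Gamma'$. Forms. $C^1(G,\mathbb{R})$ is the space of functions $\omega:\mathbb{E}(G)\to\mathbb{R}$ with $\omega(\bar e)=-\omega(e)$; put $\omega_e=\omega(e)/\ell(e)$, and let $de\in C^1(G,\mathbb{R})$ be defined by $(de)(e)=\ell(e)$ and $(de)(e')=0$ for $e'\in\mathcal{O}$, $e'\ne e$. The (partially defined) pairing is $\langle\omega,\omega'\rangle=\sum_{e\in\mathcal{O}}\omega_e\omega'_e\ell(e)$, $\|\omega\|^2=\langle\omega,\omega\rangle$,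 and $C^1_{L^2}(G,\mathbb{R})=\{\omega : \|\omega\|<\infty\}$ is a Hilbert space. Put $d^*\omega=\sum_{v\in V(G)}\big(\sum_{e\in\mathcal{O},\,e^+=v}\omega_e-\sum_{e\in\mathcal{O},\,e^-=v}\omega_e\big)\delta_v$, a signed measure ($\delta_v$ the Dirac measure). The space $\mathcal{H}_{L^2}(\Gamma)=\{\omega\in C^1_{L^2}(G,\mathbb{R}) : d^*\omega=0\}$ is closed and does not depend on the model (when an edge is subdivided, the value $\omega_e$ is kept on the pieces). Canonical measure and pushdown. The canonical measure $\mu^{\Gamma}_{\mathrm{can}}$ is the Borel measure on $\Gamma$ which on each edge of a model $G$ is a constant multiple of Lebesgue measure $dx$, with $\mu^\Gamma_{\mathrm{can}}(e)=(\pi(de))_e$, where $\pi$ is the orthogonal projection onto $\mathcal{H}_{L^2}(\Gamma)$. For the universal cover $\phi:\Gamma'\to\Gamma$ (with the metric for which $\phi$ is isometric on sheets), $\mu_{\phi,\mathrm{can}}$ is the measure on $\Gamma$ with constant density on each edge $e$ of a model of $\Gamma$ and $\mu_{\phi,\mathrm{can}}(e)=\mu^{\Gamma'}_{\mathrm{can}}(e')$ for any lift $e'$ of $e$. The measures $\mu_x$. Let $\partial\Gamma'$ be the space of ends (Gromov boundary) of the tree $\Gamma'$. For $x\in\Gamma'$ choose a model $G'$ of $\Gamma'$ with $x\in V(G')$. For $e'\in\mathbb{E}(G')$ let $T(e')$ be the connected component of $\Gamma'$ minus the interior of $e'$ that contains $e'^+$, and let $\partial T(e')\subset\partial\Gamma'$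 be its set of ends; the sets $\partial T(e')$ form a base of the topology of $\partial\Gamma'$. Let $\omega_x\in C^1_{L^2}(G',\mathbb{R})$ be the unique element of minimal norm in $\{\alpha\in C^1_{L^2}(G',\mathbb{R}) : d^*\alpha=\delta_x\}$ (this set is nonempty because $g(\Gamma)\ge2$). Then $\mu_x$ is the Borel probability measure on $\partial\Gamma'$ determined by $\mu_x(\partial T(e'))=(\omega_x)_{\bar e'}=-(\omega_x)_{e'}$ for every $e'\in\mathbb{E}(G')$ pointing away from $x$ (that is, $x\notin T(e')$). *)

(* Defs.v *)
From HB Require Import structures.
From mathcomp Require Import all_boot all_order all_algebra.
From mathcomp Require Import all_classical all_reals all_analysis.

Set Implicit Arguments.
Unset Strict Implicit.
Unset Printing Implicit Defensive.

Import Order.TTheory GRing.Theory Num.Theory.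
Import numFieldNormedType.Exports.

Local Open Scope classical_set_scope.
Local Open Scope ring_scope.

(* Measurable types are pointed in the library, hence the point o. *)
Definition borel (T : topologicalType) (o : T) : Type := T.

Section borel_instance.
Context (T : topologicalType) (o : T).

Let borelC (A : set T) : <<s (@open T) >> A -> <<s (@open T) >> (~` A).
Proof. by move=> mA; rewrite -setTD; exact: sigma_algebraCD. Qed.

HB.instance Definition _ := Choice.on (borel o).
HB.instance Definition _ := isPointed.Build (borel o) o.
HB.instance Definition _ := @isMeasurable.Build (sigma_display (@open T))
  (borel o) <<s (@open T) >> (@sigma_algebra0 _ setT (@open T)) borelC
  (@sigma_algebra_bigcup _ setT (@open T)).

End borel_instance.

Section metric_graph.
Context {R : realType} (T : metricType R).

(* [c i t] is the point corresponding to t * exp (2 pi sqrt(-1) i / n) in the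
   star S(n,r).  In the path metric of S(n,r), two points lying on distinct
   branches at distances s and t of the centre are at distance s + t. *)
Definition star_isometry (n : nat) (r : R) (c : 'I_n -> R -> T) : Prop :=
  forall i j s t, 0 <= s < r -> 0 <= t < r ->
    mdist (c i s) (c j t) = if i == j then `|s - t| else s + t.

Definition star_image (n : nat) (r : R) (c : 'I_n -> R -> T) : set T :=
  [set x | exists i t, 0 <= t < r /\ x = c i t].

(* The star neighbourhood of x need not be centred at x: a point at a small
   distance of a branch point has no centred star neighbourhood of radius at
   least eps. *)
Definition metric_graph : Prop :=
  connected [set: T] /\
  exists2 eps : R, 0 < eps & forall x : T,
    exists n r (c : 'I_n -> R -> T),
      [/\ eps <= r, star_isometry r c & nbhs x (star_image r c)].

Definition valence (x : T) (n : nat) : Prop :=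
  exists r (c : 'I_n -> R -> T),
    [/\ 0 < r, star_isometry r c, nbhs x (star_image r c) &
        forall i, c i 0 = x].

(* A vertex set V together with the oriented edges it determines.  An oriented
   edge e is a component of the complement of V with a direction; it is
   recorded through its unit-speed parametrisation
   [par e] : [0, len e] -> T, whose values outside [0, len e] are irrelevant.
   A bijective local isometry from ]0, len e[ onto the component is the same as
   an isometry for the path metric of the component.  [ori] is a reference
   orientation. *)
Record model := Model {
  vtx : set T ;
  oedge : choiceType ;
  obar : oedge -> oedge ;
  ori : set oedge ;
  len : oedge -> R ;
  par : oedge -> R -> T ;
  vtx_discrete : forall x : T,
    exists2 U, nbhs x U & U `&` vtx `<=` [set x] ;
  vtx_valence : forall x : T, ~ valence x 2 -> vtx x ;
  obarK : involutive obar ;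
  obar_neq : forall e, obar e <> e ;
  ori_obar : forall e, ori (obar e) <-> ~ ori e ;
  len_gt0 : forall e, 0 < len e ;
  len_obar : forall e, len (obar e) = len e ;
  par_obar : forall e t, 0 <= t <= len e ->
    par (obar e) t = par e (len e - t) ;
  par_inj : forall e s t, 0 < s < len e -> 0 < t < len e ->
    par e s = par e t -> s = t ;
  par_local_isometry : forall e t, 0 < t < len e ->
    exists2 d : R, 0 < d & forall s s', `|s - t| < d -> `|s' - t| < d ->
      mdist (par e s) (par e s') = `|s - s'| ;
  par_continuous : forall e, {within `[0, len e], continuous (par e)} ;
  par0_vtx : forall e, vtx (par e 0) ;
  par_component : forall e, exists2 x, ~ vtx x &
    par e @` `]0, len e[ = connected_component (~` vtx) x ;
  par_surj : forall x, ~ vtx x -> exists e, (par e @` `]0, len e[) x ;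
  par_edge_inj : forall e f, par e @` `]0, len e[ = par f @` `]0, len f[ ->
    f = e \/ f = obar e
}.

End metric_graph.

Arguments ori {R T} G : rename.

Section model_theory.
Context {R : realType} {T : metricType R} (G : model T).
Implicit Types (e : oedge G) (w : oedge G -> R) (v x : T).

Definition edge e : set T := par e @` `]0, len e[.

Definition src e : T := par e 0.

Definition tgt e : T := par e (len e).

Definition branch e : set T := connected_component (~` edge e) (tgt e).

Definition homology_cycle w : Prop :=
  [/\ (forall e, w (obar e) = - w e),
      finite_set [set e | w e != 0] &
      forall v, vtx G v ->
        \sum_(e \in ori G `&` [set e | tgt e = v]) w e -
        \sum_(e \in ori G `&` [set e | src e = v]) w e = 0].

Definition homology_basis (g : nat) (b : 'I_g -> oedge G -> R) : Prop :=
  (forall i, homology_cycle (b i)) /\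
  (forall w, homology_cycle w ->
     exists! a : 'rV[R]_g, forall e, w e = \sum_(i < g) a 0 i * b i e).

Definition C1 w : Prop := forall e, w (obar e) = - w e.

Definition coef w e : R := w e / len e.

Definition de e : oedge G -> R := fun e' =>
  if e' == e then len e else if e' == obar e then - len e else 0.

(* Sum of a family of reals, meaningful when it is absolutely summable. *)
Definition rsum (A : set (oedge G)) (f : oedge G -> R) : R :=
  fine (\esum_(e in A) (Num.max (f e) 0)%:E) -
  fine (\esum_(e in A) (Num.max (- f e) 0)%:E).

Definition pairing w w' : R :=
  rsum (ori G) (fun e => coef w e * coef w' e * len e).

Definition sqnorm w : \bar R :=
  \esum_(e in ori G) (coef w e ^+ 2 * len e)%:E.

Definition C1_L2 w : Prop := C1 w /\ (sqnorm w < +oo)%E.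

(* Mass of the signed measure d^* w at the vertex v; both sums are finite
   because vertices have finite valence. *)
Definition dstar w v : R :=
  \sum_(e \in ori G `&` [set e | tgt e = v]) coef w e -
  \sum_(e \in ori G `&` [set e | src e = v]) coef w e.

Definition harmonic w : Prop :=
  C1_L2 w /\ forall v, vtx G v -> dstar w v = 0.

Definition harmonic_projection w p : Prop :=
  harmonic p /\ forall h, harmonic h -> pairing (fun e => w e - p e) h = 0.

Definition dirac_form x w : Prop :=
  C1_L2 w /\ forall v, vtx G v -> dstar w v = (v == x)%:R.

Definition min_dirac_form x w : Prop :=
  dirac_form x w /\ forall a, dirac_form x a -> (sqnorm w <= sqnorm a)%E.

(* The measure m equals k dx on the edge e, for some constant k. *)
Definition constant_density (o : T) (m : {measure set (borel o) -> \bar R}) e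
    : Prop :=
  exists2 k : R, 0 <= k & forall A : set (borel o), measurable A ->
    A `<=` edge e ->
    m A = (k%:E * lebesgue_measure (`]0%R, len e[ `&` par e @^-1` A))%E.

End model_theory.

(* The first homology of a metric graph, computed on a model. *)
Definition has_genus {R : realType} (T : metricType R) (g : nat) : Prop :=
  exists (G : model T) (b : 'I_g -> oedge G -> R), homology_basis b.

Definition simply_connected {R : realType} (T : metricType R) : Prop :=
  connected [set: T] /\
  forall c : R -> T, {within `[0, 1], continuous c} -> c 0 = c 1 ->
    exists2 H : R * R -> T,
      {within `[0, 1]%classic `*` `[0, 1]%classic, continuous H} &
      forall t, 0 <= t <= 1 ->
        [/\ H (0, t) = c t, H (1, t) = c 0, H (t, 0) = c 0 & H (t, 1) = c 0].

Section universal_cover.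
Context {R : realType} {T' T : metricType R} (phi : T' -> T).

Definition isometric_covering : Prop :=
  [/\ continuous phi,
      range phi = [set: T] &
      forall x : T, exists2 U : set T, open U /\ U x &
        exists F : set (set T'),
          [/\ \bigcup_(S in F) S = phi @^-1` U,
              trivIset F id &
              forall S, F S -> [/\ open S, phi @` S = U &
                forall y z, S y -> S z ->
                  mdist (phi y) (phi z) = mdist y z]]].

Definition universal_cover : Prop :=
  [/\ metric_graph T', isometric_covering & simply_connected T'].

Definition edge_lift (G : model T) (G' : model T') (e : oedge G) (e' : oedge G') :=
  len e' = len e /\
  forall t, 0 <= t <= len e -> phi (par e' t) = par e t.

End universal_cover.

(* An end selects a component of the complement of every compact set K, in a
   compatible way; the value at a non-compact set is irrelevant, and is set to
   set0 so that equal ends are equal as functions. *)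
Definition is_end {T : topologicalType} (f : set T -> set T) : Prop :=
  [/\ forall K, compact K ->
        exists2 x, ~ K x & f K = connected_component (~` K) x,
      forall K L, compact K -> compact L -> K `<=` L -> f L `<=` f K &
      forall K, ~ compact K -> f K = set0].

Definition ends (T : topologicalType) : Type :=
  {f : set T -> set T | is_end f}.

Section ends_topology.
Context (T : topologicalType).

HB.instance Definition _ := gen_eqMixin (ends T).
HB.instance Definition _ := gen_choiceMixin (ends T).

(* The sets of ends selecting a given component of the complement of a given
   compact set form a base of the topology. *)
Definition ends_open : set_system (ends T) := [set U | forall x, U x ->
  exists2 K, compact K & [set y : ends T | sval y K = sval x K] `<=` U].

Let ends_openT : ends_open setT.
Proof. by move=> x _; exists set0; [exact: compact0|]. Qed.

Let ends_openI : setI_closed ends_open.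
Proof.
move=> A B oA oB x [/oA[K cK KA] /oB[L cL LB]].
exists (K `|` L); first exact: compactU.
have cKL := compactU cK cL.
move=> y /= yx; have [K' L'] : sval y K = sval x K /\ sval y L = sval x L.
  have step (M : set T) : compact M -> M `<=` K `|` L ->
      sval y M = sval x M.
    move=> cM MKL.
    have [xc xm _] := svalP x; have [yc ym _] := svalP y.
    have [p np pE] := xc _ cM; have [q nq qE] := yc _ cM.
    have [z zx] : exists z, sval x (K `|` L) z.
      have [w nw wE] := xc _ cKL; exists w; rewrite wE.
      exact: connected_component_refl.
    have := xm _ _ cM cKL MKL _ zx; rewrite pE => zp.
    have := ym _ _ cM cKL MKL; rewrite yx => /(_ _ zx); rewrite qE => zq.
    by rewrite (same_connected_component zp) (same_connected_component zq).
  by split; apply: step.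
by split; [exact: KA|exact: LB].
Qed.

Let ends_open_bigU (I : Type) (f : I -> set (ends T)) :
  (forall i, ends_open (f i)) -> ends_open (\bigcup_i f i).
Proof.
move=> fo x [i _ fix_]; have [K cK Kf] := fo i x fix_.
by exists K => // y /Kf ?; exists i.
Qed.

HB.instance Definition _ := isOpenTopological.Build (ends T)
  ends_openT ends_openI ends_open_bigU.

End ends_topology.

Section measures_on_ends.
Context {R : realType} {T : metricType R} (G : model T).

Definition branch_ends (e : oedge G) : set (ends T) :=
  [set y | exists2 K, compact K & sval y K `<=` branch e].

End measures_on_ends.

(* The measure mu_x on ends: the minimal-norm form w with d^* w = delta_x flows
   towards x, so the mass of the ends beyond an edge e pointing away from x is
   -w_e. It does not depend on the model containing x as a vertex. *)
Definition end_measure {R : realType} {T : metricType R} (o : ends T)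
    (x : T) (m : probability (borel o) R) : Prop :=
  forall G : model T, vtx G x ->
    exists2 w, min_dirac_form x w & forall e : oedge G, ~ branch e x ->
      m (branch_ends e) = (- coef w e)%:E.

(* Vertex sets are null: the canonical measure is continuous.  The conditions
   for different models are compatible, and agree under subdivision. *)
Definition canonical_measure {R : realType} {T : metricType R} (o : T)
    (m : {measure set (borel o) -> \bar R}) : Prop :=
  forall G : model T, m (vtx G) = 0%E /\
    forall e : oedge G, constant_density m e /\
      exists2 p, harmonic_projection (de e) p & m (edge e) = (coef p e)%:E.

Definition pushdown_measure {R : realType} {T' T : metricType R}
    (phi : T' -> T) (o' : T') (m' : {measure set (borel o') -> \bar R})
    (o : T) (m : {measure set (borel o) -> \bar R}) : Prop :=
  forall G : model T, m (vtx G) = 0%E /\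
    forall e : oedge G, constant_density m e /\
      forall (G' : model T') (e' : oedge G'), edge_lift phi e e' ->
        m (edge e) = m' (edge e').

Section signed_measures.
Context d (X : measurableType d) (R : realType).

(* The total mass of the variation of nu; it does not depend on the Hahn
   decomposition. *)
Definition charge_tv (nu : {charge set X -> \bar R}) : \bar R :=
  let P := cid (Hahn_decomposition nu) in
  charge_variation (projT2 (cid (projT2 P))) [set: X].

Definition prob_diff (m n : probability X R) : {charge set X -> \bar R} :=
  cadd (charge_of_finite_measure m) (copp (charge_of_finite_measure n)).

End signed_measures.

(* Main.v *)
(* Let w0 and w1 be the minimal forms with d^* = delta at the two ends of an
   edge e of the tree T', and let p be the projection of de to the harmonic
   forms.  The form w1 - w0 is orthogonal to the harmonic forms and has the same
   d^* as de, so w1 - w0 = de - p; hence mu_(e+) - mu_(e-) gives mass p_f to the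
   ends beyond any oriented edge f.  On the part of the tree beyond e both p and
   w0 minimise the energy for a given flow through e, so they are proportional
   there.  As the sets of ends beyond edges form a pi-system generating the Borel
   sets, mu_(e+) - mu_(e-) is a nonnegative multiple of mu_(e-) on the ends
   beyond e, and, exchanging the two ends of e, nonpositive on the other ends.
   Its total variation is therefore 2 p_e, which is (a).
     For (b), cut e at a point x.  Harmonic forms are constant along e, so the
   projections of the two pieces are proportional to their lengths.  Thus mu_x is
   affine in x along e, and its derivative is (mu_(e+) - mu_(e-)) / len e. *)

Require Import Defs.
From HB Require Import structures.
From mathcomp Require Import all_boot all_order all_algebra.
From mathcomp Require Import all_classical all_reals all_analysis.
From mathcomp Require Import measurable_realfun zify ring lra.

Set Implicit Arguments.
Unset Strict Implicit.
Unset Printing Implicit Defensive.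

Import Order.TTheory GRing.Theory Num.Theory.
Import numFieldNormedType.Exports.

Local Open Scope classical_set_scope.
Local Open Scope ring_scope.

(** * Local structure of a metric graph *)

(** The tree structure is not given directly. Simple connectedness only says that loops contract,
    whereas all the combinatorics rests on each edge separating the graph. The bridge is a cocycle
    counting crossings of the midpoint of an edge: it is locally a difference, so it sums to zero
    over a fine subdivision of a contractible loop, while a loop crossing the midpoint once would
    give one. Minimality of the Dirac forms enters only as orthogonality to harmonic forms, and the
    projection [p] of [de e] only as a harmonic form representing evaluation at [e]. Proportionality
    beyond [e] comes from a test form: the combination of [p] and [w0] without flow through [e]
    stays harmonic when cut off at [e], and it is orthogonal to itself. The factor one half in the
    theorem reflects that total variation counts both the mass gained beyond [e] and the equal mass
    lost on the other side. *)

Section connectedness.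
Context {X : topologicalType}.
Implicit Types A C : set X.

(** Local constancy makes the part of [C] inside [A] both relatively open and relatively closed; the
    two interiors in the proof are the ambient open sets witnessing this. *)
Lemma connected_locally_constant C A x :
  connected C -> C x -> A x ->
  (forall u, C u -> \forall v \near u, C v -> (A u <-> A v)) -> C `<=` A.
Proof.
move=> cC Cx Ax loc; suff <- : C `&` A = C by move=> y [].
apply: cC; first by exists x.
- exists (interior [set v | C v -> A v]); first exact: open_interior.
  apply/seteqP; split=> u [Cu Hu]; split=> //.
    by move: (loc u Cu); apply: filterS => v H /H [+ _]; exact.
  by have := nbhs_singleton Hu; exact.
- exists (~` interior [set v | C v -> ~ A v]).
    by rewrite closedC; exact: open_interior.
  apply/seteqP; split=> u [Cu Hu]; split=> //.
    by move=> /nbhs_singleton /(_ Cu); exact.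
  apply: contrapT => nAu; apply: Hu.
  by move: (loc u Cu); apply: filterS => v H /H [_ +] Av; move/(_ Av).
Qed.

End connectedness.

Section metric_graph_topology.
Context {R : realType} {T : metricType R}.
Hypothesis mT : metric_graph T.
Implicit Types (x y : T) (r : R).

Lemma nbhs_mdist_ball x (A : set T) :
  nbhs x A <-> exists2 d, 0 < d & forall y, mdist x y < d -> A y.
Proof.
split=> [/nbhs_ballP[d /= d0 dA]|[d d0 dA]].
  by exists d => // y xy; apply: dA; rewrite ballEmdist.
by apply/nbhs_ballP; exists d => //= y; rewrite ballEmdist; exact: dA.
Qed.

Lemma star_mdist0 n r (c : 'I_n -> R -> T) i s x : star_isometry r c ->
  c i 0 = x -> 0 <= s < r -> mdist x (c i s) = s.
Proof.
move=> cr <- /andP[s0 sr]; rewrite cr ?eqxx ?s0 ?sr//; last first.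
  by rewrite lexx (le_lt_trans s0).
by rewrite sub0r normrN ger0_norm.
Qed.

(** The star given by [metric_graph] need not be centred at [x]. If [x] lies at distance [t > 0]
    along a branch, that branch is read in both directions from [x] as a two-branched star, of
    radius small enough to stay inside the branch. *)
Lemma valence_ex x : exists n, valence x n.
Proof.
have [_ [eps eps0 /(_ x)[n [r [c [er cr xc]]]]]] := mT.
have r0 : 0 < r by exact: lt_le_trans er.
have [i [t [/andP[]]]] := nbhs_singleton xc; rewrite le_eqVlt => /predU1P[<-|t0] tr xE.
  exists n, r, c; split => // j; rewrite xE.
  apply: mdist_positivity; rewrite cr ?lexx//.
  by case: ifP => _; rewrite ?subrr ?normr0 ?addr0.
pose c' (j : 'I_2) (s : R) := if j == 0 then c i (t + s) else c i (t - s).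
exists 2, (Num.min t (r - t)), c'; split.
- by rewrite lt_min t0 subr_gt0.
- move=> j k s u; rewrite !lt_min => /and3P[s0 st sr] /and3P[u0 ut ur].
  have jk : (j == k) = ((j == 0) == (k == 0)).
    by case: j k => [[|[|//]] ?] [[|[|//]] ?].
  rewrite jk /c'; case: (j == 0); case: (k == 0) => /=;
    rewrite cr ?eqxx //; try (by apply/andP; split; lra).
  + by congr `|_|; lra.
  + by rewrite ger0_norm; lra.
  + by rewrite ler0_norm; lra.
  + by rewrite distrC; congr `|_|; lra.
- have [d d0 dc] := (nbhs_mdist_ball _ _).1 xc.
  apply/nbhs_mdist_ball; exists (Num.min d (Num.min t (r - t))).
    by rewrite !lt_min d0 t0 subr_gt0.
  move=> y; rewrite !lt_min => /and3P[yd yt yr].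
  have [j [u [/andP[u0 ur] yE]]] := dc y yd.
  move: yt yr; rewrite xE yE cr ?(ltW t0) ?u0//; case: eqVneq => [<-|_]; last lra.
  have [tu|ut] := leP t u => yt yr.
    exists ord0, (u - t); rewrite /c' /= [t + _]addrC -addrA addNr addr0.
    by split => //; rewrite lt_min; move: yt yr; rewrite ler0_norm; lra.
  exists (@Ordinal 2 1 isT), (t - u); rewrite /c' /=; split.
    by rewrite lt_min; move: yt yr; rewrite ger0_norm; lra.
  by rewrite opprD opprK addrA subrr add0r.
- by move=> j; rewrite /c'; case: ifP; rewrite ?addr0 ?subr0.
Qed.

Lemma star_shrink n r r' (c : 'I_n -> R -> T) x : 0 < r' <= r ->
  star_isometry r c -> nbhs x (star_image r c) -> (forall i, c i 0 = x) ->
  star_isometry r' c /\ nbhs x (star_image r' c).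
Proof.
move=> /andP[r0 rr] cr xc c0; split.
  by move=> i j s t /andP[? ?] /andP[? ?]; apply: cr; lra.
have [d d0 dc] := (nbhs_mdist_ball _ _).1 xc.
apply/nbhs_mdist_ball; exists (Num.min d r'); first by rewrite lt_min d0.
move=> y; rewrite lt_min => /andP[/dc[i [t [tr ->]]]].
rewrite (star_mdist0 cr (c0 i) tr) => tr'; exists i, t; split => //.
by case/andP: tr => ->.
Qed.

End metric_graph_topology.

Section model_topology.
Context {R : realType} {T : metricType R}.
Hypothesis mT : metric_graph T.
Context (G : model T).
Implicit Types (e f g : oedge G) (x y v : T).

Definition cedge e : set T := par e @` `[0, len e].

Let lt0len := @len_gt0 R T G.

Lemma edge_cedge e : edge e `<=` cedge e.
Proof.
move=> _ [t /= + <-]; rewrite in_itv /= => /andP[t0 tl]; exists t => //=.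
by rewrite in_itv /= !ltW.
Qed.

Lemma cedge_src e : cedge e (src e).
Proof. by exists 0 => //=; rewrite in_itv /= lexx ltW. Qed.

Lemma cedge_tgt e : cedge e (tgt e).
Proof. by exists (len e) => //=; rewrite in_itv /= lexx ltW. Qed.

Lemma src_obar e : src (obar e) = tgt e.
Proof. by rewrite /src par_obar ?subr0// lexx ltW. Qed.

Lemma tgt_obar e : tgt (obar e) = src e.
Proof. by rewrite /tgt len_obar par_obar ?subrr// lexx ltW. Qed.

Lemma edge_obar e : edge (obar e) = edge e.
Proof.
rewrite /edge len_obar; apply/seteqP; split=> _ [t /= + <-];
    rewrite in_itv /= => /andP[t0 tl]; exists (len e - t) => /=.
- by rewrite in_itv /=; lra.
- by rewrite par_obar// !ltW.
- by rewrite in_itv /=; lra.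
- by rewrite par_obar ?opprB 1?addrC ?subrK//; lra.
Qed.

Lemma cedge_obar e : cedge (obar e) = cedge e.
Proof.
rewrite /cedge len_obar; apply/seteqP; split=> _ [t /= + <-];
    rewrite in_itv /= => /andP[t0 tl]; exists (len e - t) => /=.
- by rewrite in_itv /=; lra.
- by rewrite par_obar// t0.
- by rewrite in_itv /=; lra.
- by rewrite par_obar ?opprB 1?addrC ?subrK//; lra.
Qed.

Lemma edge_notin_vtx e : edge e `<=` ~` vtx G.
Proof.
have [x _ exE] := par_component e; rewrite /edge exE.
exact: connected_component_sub.
Qed.

Lemma src_vtx e : vtx G (src e). Proof. exact: par0_vtx. Qed.

Lemma tgt_vtx e : vtx G (tgt e). Proof. by rewrite -src_obar; exact: src_vtx. Qed.

Lemma src_notin_edge e f : ~ edge e (src f).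
Proof. by move=> /edge_notin_vtx; apply; exact: src_vtx. Qed.

Lemma tgt_notin_edge e f : ~ edge e (tgt f).
Proof. by move=> /edge_notin_vtx; apply; exact: tgt_vtx. Qed.

Lemma cedgeP e x : cedge e x -> [\/ x = src e, x = tgt e | edge e x].
Proof.
case=> t /= + <-; rewrite in_itv /= => /andP[]; rewrite le_eqVlt.
case/predU1P => [<- _|t0]; first by constructor 1.
rewrite le_eqVlt => /predU1P[->|tl]; first by constructor 2.
by constructor 3; exists t => //=; rewrite in_itv /= t0.
Qed.

Lemma edge_eq_meet e f x : edge e x -> edge f x -> edge e = edge f.
Proof.
have [y _ eE] := par_component e; have [z _ fE] := par_component f.
rewrite /edge eE fE => /same_connected_component -> /same_connected_component.
by move->.
Qed.

Lemma edge_inj e f x : edge e x -> edge f x -> f = e \/ f = obar e.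
Proof. by move=> ex fx; apply: par_edge_inj; exact: edge_eq_meet ex fx. Qed.

Lemma edge_meet_cedge e f x : edge e x -> cedge f x -> edge f x.
Proof.
move=> ex /cedgeP[xE|xE|//]; rewrite xE in ex.
  by case: (src_notin_edge ex).
by case: (tgt_notin_edge ex).
Qed.

Lemma edge_mid e : edge e (par e (len e / 2)).
Proof. by exists (len e / 2) => //=; rewrite in_itv /=; have := lt0len e; lra. Qed.

Lemma par_in_edge e t : 0 < t < len e -> edge e (par e t).
Proof. by move=> tl; exists t. Qed.

(** An interior point of an edge is not a vertex, so it has valence 2. By local isometry the points
    at parameters [t + s] and [t - s] lie at distance [s] from it, and on different branches because
    they are distinct. With only two branches available, every nearby point of the star is one of
    them. *)
Lemma par_open e a b : 0 <= a -> b <= len e -> open (par e @` `]a, b[).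
Proof.
move=> a0 bl; rewrite openE => y [t /= + tE]; rewrite in_itv /= => /andP[at_ tb].
have tl : 0 < t < len e by lra.
have : valence y 2.
  apply: contrapT => /(@vtx_valence _ _ G); apply: (@edge_notin_vtx e).
  by rewrite -tE; exact: par_in_edge.
move=> [r [c [r0 cr yc c0]]].
have [d d0 dI] := par_local_isometry tl.
have [q q0 qc] := (nbhs_mdist_ball _ _).1 yc.
apply/nbhs_mdist_ball.
exists (Num.min (Num.min d q) (Num.min (t - a) (b - t))).
  by rewrite !lt_min d0 q0 !subr_gt0 at_.
have close s : `|s| < d -> mdist y (par e (t + s)) = `|s|.
  move=> sd; rewrite -tE dI ?subrr ?normr0//.
    by rewrite opprD addrA subrr sub0r normrN.
  by rewrite addrC addrA [- t + t]addrC subrr add0r.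
have hit s : `|s| < d -> `|s| < q -> exists k, par e (t + s) = c k `|s|.
  move=> sd sq; have [|k [u [ur kE]]] := qc (par e (t + s)); first by rewrite close.
  have := close _ sd; rewrite {1}kE (star_mdist0 cr (c0 k) ur) => <-.
  by exists k.
move=> z; rewrite !lt_min => /andP[/andP[zd zq] /andP[za zb]].
have [i [s [/andP[s0 sr] zE]]] := qc z zq.
move: zd zq za zb; rewrite zE (star_mdist0 cr (c0 i)) ?s0//.
move: s0; rewrite le_eqVlt => /predU1P[<- _ _ _ _|s0 sd sq sa sb].
  by exists t; rewrite /= ?in_itv /= ?at_// c0.
have ns : `|- s| = s by rewrite normrN gtr0_norm.
have ps : `|s| = s by rewrite gtr0_norm.
have [||j jE] := hit s; rewrite ?ps//.
have [||k kE] := hit (- s); rewrite ?ns//.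
rewrite ps in jE; rewrite ns in kE.
have jk : j != k.
  apply/eqP => jk; have := dI (t + s) (t - s); rewrite jE kE jk mdistxx.
  rewrite [t + s]addrC addrK ps => /(_ sd).
  rewrite addrAC subrr sub0r ns => /(_ sd) /esym/eqP.
  by rewrite normr_eq0; apply/negP; lra.
have [->|->] : i = j \/ i = k.
  case: i j k jk {zE jE kE} => [[|[|//]] ?] [[|[|//]] ?] [[|[|//]] ?] //= _;
    by [left; apply: val_inj|right; apply: val_inj].
- by exists (t + s) => //=; rewrite in_itv /=; lra.
- by exists (t - s) => //=; rewrite in_itv /=; lra.
Qed.

Lemma edge_open e : open (edge e).
Proof. by apply: par_open. Qed.

Lemma par_segment_continuous e a b : 0 <= a -> b <= len e ->
  {within `[a, b], continuous (par e)}.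
Proof.
move=> a0 bl; apply: continuous_subspaceW (@par_continuous _ _ _ e).
by move=> t /=; rewrite !in_itv /=; lra.
Qed.

Lemma par_compact e a b : 0 <= a -> b <= len e -> compact (par e @` `[a, b]).
Proof.
move=> a0 bl; apply: continuous_compact; last exact: segment_compact.
exact: par_segment_continuous.
Qed.

Lemma par_closed e a b : 0 <= a -> b <= len e -> closed (par e @` `[a, b]).
Proof.
by move=> a0 bl; apply: compact_closed; [exact: metric_hausdorff|exact: par_compact].
Qed.

Lemma cedge_compact e : compact (cedge e).
Proof. exact: par_compact. Qed.

Lemma cedge_closed e : closed (cedge e).
Proof. exact: par_closed. Qed.

Lemma cedge_connected e : connected (cedge e).
Proof.
apply: connected_continuous_connected; first exact: segment_connected.
exact: par_continuous.
Qed.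

(** Shrink the star until it contains no other vertex. Each open branch is then connected and free
    of vertices, so it lies in one edge; its points approach [x], which therefore belongs to the
    closed edge. *)
Lemma vtx_star x : vtx G x -> exists n r (c : 'I_n -> R -> T),
  [/\ 0 < r, nbhs x (star_image r c), forall i, c i 0 = x &
    forall i, exists2 e, cedge e x & forall s, 0 < s < r -> edge e (c i s)].
Proof.
move=> vx; have [n [r [c [r0 cr xc c0]]]] := valence_ex mT x.
have [U xU UV] := vtx_discrete G x.
have [q q0 qU] := (nbhs_mdist_ball _ _).1 xU.
pose r' := Num.min q r.
have r'0 : 0 < r' by rewrite lt_min q0.
have [|cr' xc'] := star_shrink (r' := r') _ cr xc c0.
  by rewrite r'0 ge_min lexx orbT.
exists n, r', c; split=> // i.
have xd s : 0 <= s < r' -> mdist x (c i s) = s by exact: star_mdist0.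
have nv s : 0 < s < r' -> ~ vtx G (c i s).
  move=> /andP[s0 sr] vc; have xds : mdist x (c i s) = s.
    by rewrite xd// ltW.
  have : (U `&` vtx G) (c i s).
    by split=> //; apply: qU; rewrite xds; move: sr; rewrite lt_min => /andP[].
  by move/UV => /= ci; move: xds s0; rewrite ci mdistxx => <-; rewrite ltxx.
have t0 : 0 < r' / 2 < r' by lra.
have [e et] := par_surj (nv _ t0).
have br s : 0 < s < r' -> edge e (c i s).
  move=> sr.
  have sub : (c i @` `]0, r'[) `<=` ~` vtx G.
    by move=> _ [u /= + <-]; rewrite in_itv /=; exact: nv.
  have con : connected (c i @` `]0, r'[).
    apply: connected_continuous_connected.
      exact/connected_intervalP/interval_is_interval.
    apply/subspace_continuousP => u /=; rewrite in_itv /= => /andP[u0 ur].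
    move=> A /= /nbhs_mdist_ball[d d0 dA]; apply/nbhs_ballP; exists d => //= v.
    rewrite /ball/= in_itv /= => uv /andP[v0 vr]; apply: dA.
    by rewrite cr' ?eqxx// !ltW.
  have [z nz eE] := par_component e.
  move: et; rewrite /edge eE => /same_connected_component ->.
  apply: (connected_component_max _ sub con); last by exists s.
  by exists (r' / 2).
exists e => //; apply: contrapT => nex.
have : nbhs x (~` cedge e).
  by apply: open_nbhs_nbhs; split=> //; exact/closed_openC/cedge_closed.
move=> /nbhs_mdist_ball[d d0 dn].
pose s := Num.min d r' / 2.
have [s0 sd sr] : [/\ 0 < s, s < d & s < r'].
  have m0 : 0 < Num.min d r' by rewrite lt_min d0.
  have md : Num.min d r' <= d by rewrite ge_min lexx.
  have mr : Num.min d r' <= r' by rewrite ge_min lexx orbT.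
  by rewrite /s; split; lra.
apply: (dn (c i s)); first by rewrite xd// ltW.
by apply/edge_cedge/br; rewrite s0.
Qed.

(** Turns topology into combinatorics: a property that does not change along closed edges is locally
    constant. *)
Lemma near_cedge x : \forall y \near x,
  y = x \/ exists2 g, cedge g x & edge g y.
Proof.
have [vx|/par_surj[e ex]] := pselect (vtx G x); last first.
  have := edge_open e; rewrite openE => /(_ _ ex); apply: filterS => y ey.
  by right; exists e => //; exact: edge_cedge.
have [n [r [c [r0 xc c0 cE]]]] := vtx_star vx.
apply: filterS xc => _ [i [t [/andP[+ tr ->]]]].
rewrite le_eqVlt => /predU1P[<-|t0]; [by left|right].
by have [e ex eE] := cE i; exists e => //; apply: eE; rewrite t0.
Qed.

(** By continuity at parameter 0, an edge leaving [v] has interior points on the star at [v]. It is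
    thus, up to reversal, the edge carrying one of the finitely many branches. *)
Lemma finite_src v : finite_set [set e : oedge G | src e = v].
Proof.
have [vv|nv] := pselect (vtx G v); last first.
  rewrite (_ : mkset _ = set0); first exact: finite_set0.
  by apply/seteqP; split=> // e /= ev; apply: nv; rewrite -ev; exact: src_vtx.
have [n [r [c [r0 vc c0 cE]]]] := vtx_star vv.
have /choice[E EP] : forall i : 'I_n, exists e : oedge G,
    forall s, 0 < s < r -> edge e (c i s).
  by move=> i; have [e _ H] := cE i; exists e.
have : finite_set ((E @` setT) `|` ((@obar _ _ G \o E) @` setT)).
  by rewrite finite_setU; split; apply: finite_image; exact: finite_finset.
apply: sub_finite_set.
move=> e /= ev; have := (@subspace_continuousP _ _ _ _).1 (@par_continuous _ _ _ e) 0.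
rewrite /= in_itv /= lexx (ltW (lt0len e)) => /(_ isT (star_image r c)).
rewrite -[X in nbhs X](_ : v = _); last by rewrite -ev.
move=> /(_ vc) /nbhs_ballP[d /= d0 dP].
pose s := Num.min d (len e) / 2.
have [s0 sd sl] : [/\ 0 < s, s < d & s < len e].
  have m0 : 0 < Num.min d (len e) by rewrite lt_min d0 lt0len.
  have md : Num.min d (len e) <= d by rewrite ge_min lexx.
  have mr : Num.min d (len e) <= len e by rewrite ge_min lexx orbT.
  by rewrite /s; split; lra.
have es : edge e (par e s) by apply: par_in_edge; rewrite s0.
have [||i [u [/andP[+ ur]] sE]] := dP s.
- by rewrite /ball /= sub0r normrN gtr0_norm.
- by rewrite in_itv /= !ltW.
rewrite le_eqVlt => /predU1P[u0|u0].
  case: (edge_notin_vtx es); suff -> : par e s = v by [].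
  by have := sE; rewrite -u0 c0.
have eE : edge (E i) (par e s).
  by have := EP i u; rewrite u0 => /(_ ur); rewrite -sE.
by case: (edge_inj eE es) => ->; [left|right]; exists i.
Qed.

End model_topology.

(** * Edges of a simply connected graph are separating *)

Section edge_connectedness.
Context {R : realType} {T : metricType R}.
Hypothesis mT : metric_graph T.
Context (G : model T).
Implicit Types (e f g : oedge G) (x y v : T).

(** Propagation along edges, the form in which the later global connectedness arguments are run. *)
Lemma connected_edge_constant (C A : set T) x : connected C -> C x -> A x ->
  (forall g u v, C u -> C v -> cedge g u -> edge g v -> (A u <-> A v)) -> C `<=` A.
Proof.
move=> cC Cx Ax loc; apply: (connected_locally_constant cC Cx Ax) => u Cu.
apply: filterS (near_cedge mT G u) => v [->//|[g gu gv]] Cv.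
exact: loc gu gv.
Qed.

Lemma cedge_avoid e g v : ~ edge e v -> edge g v -> cedge g `<=` ~` edge e.
Proof.
move=> nev gv z gz ez; apply: nev.
by rewrite (edge_eq_meet ez (edge_meet_cedge ez gz)).
Qed.

End edge_connectedness.

(** * Paths and their concatenation *)

Section paths.
Context {R : realType} {T : topologicalType}.
Implicit Types (c : R -> T) (S : set T) (x y z : T).

Definition clamp (t : R) : R := if t <= 0 then 0 else if 1 <= t then 1 else t.

Lemma clamp_itv t : 0 <= clamp t <= 1.
Proof.
rewrite /clamp; case: (leP t 0) => ?; first by rewrite lexx ler01.
by case: (leP 1 t) => ?; lra.
Qed.

Lemma clamp_id t : 0 <= t <= 1 -> clamp t = t.
Proof. by rewrite /clamp; case: (leP t 0) => ?; [|case: (leP 1 t) => ?]; lra. Qed.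

Lemma clamp_le0 t : t <= 0 -> clamp t = 0.
Proof. by rewrite /clamp => ->. Qed.

Lemma clamp_ge1 t : 1 <= t -> clamp t = 1.
Proof. by rewrite /clamp => t1; rewrite t1 ifF//; apply/negbTE; rewrite -ltNge; lra. Qed.

Lemma clamp_lipschitz s t : `|clamp s - clamp t| <= `|s - t|.
Proof.
have := ler_norm (s - t); have := ler_norm (t - s); rewrite (distrC t) => ? ?.
rewrite ler_norml /clamp; have [?|?] := leP s 0; have [?|?] := leP t 0;
  have [?|?] := leP 1 s; have [?|?] := leP 1 t; apply/andP; split; lra.
Qed.

(** A path is a map continuous on the whole line and constant outside the unit interval, so that
    concatenation and continuity need no subspace topology. *)
Definition joins c S x y := [/\ continuous c,
  forall t, t <= 0 -> c t = x, forall t, 1 <= t -> c t = y & forall t, S (c t)].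

Definition cat_path c c' (t : R) : T := if t <= 2^-1 then c (2 * t) else c' (2 * t - 1).

Lemma joins_cat c c' S x y z :
  joins c S x y -> joins c' S y z -> joins (cat_path c c') S x z.
Proof.
move=> [cc c0 c1 cS] [cc' c'0 c'1 c'S]; rewrite /cat_path; split.
- move=> t; have c2 : (c (2 * s)) @[s --> t] --> c (2 * t).
    apply: (@continuous_comp R R T (fun s => 2 * s) c t); last exact: cc.
    by apply: cvgM; [exact: cvg_cst|exact: cvg_id].
  have c'2 : (c' (2 * s - 1)) @[s --> t] --> c' (2 * t - 1).
    apply: (@continuous_comp R R T (fun s => 2 * s - 1) c' t); last exact: cc'.
    apply: cvgB; last exact: cvg_cst.
    by apply: cvgM; [exact: cvg_cst|exact: cvg_id].
  have [t2|t2|t2] := ltgtP t 2^-1.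
  + rewrite /continuous_at (ltW t2); apply: cvg_trans c2; apply: near_eq_cvg.
    near=> s; rewrite ifT//; near: s; exact: lt_le_nbhsl.
  + rewrite /continuous_at leNgt t2 /=; apply: cvg_trans c'2; apply: near_eq_cvg.
    near=> s; rewrite leNgt ifF//; apply/negbF; near: s; exact: lt_nbhsr.
  + rewrite /continuous_at t2 lexx; rewrite t2 mulfV// subrr in c2 c'2 *.
    move=> W /= cW; have := c2 _ cW; have c'W : nbhs (c' 0) W by rewrite c'0// -(c1 1).
    have := c'2 _ c'W; rewrite /= !near_simpl => H1 H2.
    by near=> s; case: ifP => _; near: s.
- by move=> t t0; rewrite ifT; [apply: c0|]; lra.
- move=> t t1; rewrite ifF; [apply: c'1; lra|].
  by apply/negbTE; rewrite -ltNge; lra.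
- by move=> t; case: ifP.
Unshelve. all: by end_near. Qed.

Definition joined S x y := exists c, joins c S x y.

Lemma joined_trans S x y z : joined S x y -> joined S y z -> joined S x z.
Proof. by move=> [c cP] [c' cP']; exists (cat_path c c'); exact: joins_cat cP cP'. Qed.

Lemma joined_refl S x : S x -> joined S x x.
Proof. by move=> Sx; exists (cst x); split=> // t; exact: cvg_cst. Qed.

Lemma joinedS S S' x y : S `<=` S' -> joined S x y -> joined S' x y.
Proof. by move=> SS [c [cc c0 c1 cS]]; exists c; split=> // t; exact: SS. Qed.

End paths.

Section grid.
Context {R : realType} {T : topologicalType}.

(* Compare neighbouring columns of a fine grid in the homotopy square. *)
Lemma null_homotopic_sum0 (d : T -> T -> R) (c : R -> T) (H : R * R -> T) :
  (forall z : T, exists2 U : set T, nbhs z U & exists k : T -> R,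
     forall x y, U x -> U y -> d x y = k y - k x) ->
  {within `[0, 1]%classic `*` `[0, 1]%classic, continuous H} ->
  (forall t, 0 <= t <= 1 ->
    [/\ H (0, t) = c t, H (1, t) = c 0, H (t, 0) = c 0 & H (t, 1) = c 0]) ->
  \forall N \near \oo, \sum_(0 <= j < N.+1)
    d (c (j%:R / N.+1%:R)) (c (j.+1%:R / N.+1%:R)) = 0.
Proof.
move=> dloc cH Hc.
set K := `[0, 1] `*` `[0, 1] in cH.
have d0 x : d x x = 0.
  have [U xU [k kP]] := dloc x.
  by rewrite kP ?subrr//; exact: nbhs_singleton.
(* Lebesgue number argument: for large [N] every grid cell maps into a set where [d] is a
   difference. The radius has numerator 2 because neighbouring grid points are at distance 1 / (N +
   1) and balls are open. *)
pose P (N : nat) (x : R * R) := exists k : T -> R, forall y z : R * R, K y -> K z ->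
  ball x (2 / N.+1%:R) y -> ball x (2 / N.+1%:R) z -> d (H y) (H z) = k (H z) - k (H y).
have : \forall N \near \oo, K `<=` P N.
  have cK : compact K by apply: compact_setX; exact: segment_compact.
  apply: ((near_covering_withinP K).2 ((compact_near_coveringP K).1 cK)) => x Kx.
  have [U xU [k kP]] := dloc (H x).
  have := (subspace_continuousP _ _).1 cH x Kx U xU.
  move=> /nbhs_ballP[eps /= eps0 epsU].
  have e2 : 0 < eps / 2 by rewrite divr_gt0.
  exists (ball x (eps / 2), [set N | 2 / N.+1%:R < eps / 2 :> R]) => /=.
    split; first exact: nbhsx_ballx.
    have e4 : 0 < eps / 4 by rewrite divr_gt0.
    apply: filterS (near_infty_natSinv_lt (PosNum e4)) => N /=.
    by rewrite (_ : eps / 2 = 2 * (eps / 4)) ?ltr_pM2l//; lra.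
  move=> [x' N] /= [xx' Ne] Kx'; exists k => y z Ky Kz x'y x'z.
  have sub w : ball x' (2 / N.+1%:R) w -> ball x eps w.
    move=> x'w; rewrite [eps]splitr; apply: ball_triangle xx' _.
    by apply: le_ball x'w; exact: ltW.
  by apply: kP; apply: epsU => //; exact: sub.
apply: filterS => N KP.
pose h i j : R * R := (i%:R / N.+1%:R, j%:R / N.+1%:R).
have N0 : 0 < N.+1%:R :> R by rewrite ltr0n.
have itvh i : (i <= N.+1)%N -> 0 <= (i%:R / N.+1%:R : R) <= 1.
  by move=> iN; rewrite divr_ge0//= ler_pdivrMr// mul1r ler_nat.
have Kh i j : (i <= N.+1)%N -> (j <= N.+1)%N -> K (h i j).
  by move=> iN jN; split; rewrite /= in_itv /= itvh.
have hh (i i' : nat) : (i <= i' <= i.+1)%N -> ball (i%:R / N.+1%:R : R) (2 / N.+1%:R) (i'%:R / N.+1%:R).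
  move=> ii'; rewrite /ball /= -mulrBl normrM [X in _ * X]ger0_norm; last by rewrite invr_ge0.
  rewrite ltr_pM2r ?invr_gt0//.
  have [->|->] : (i' = i \/ i' = i.+1)%N by lia.
    by rewrite subrr normr0.
  by rewrite -addn1 natrD opprD addrA subrr sub0r normrN normr1 ltr1n.
pose S i := \sum_(0 <= j < N.+1) d (H (h i j)) (H (h i j.+1)).
have Sstep i : (i < N.+1)%N -> S i.+1 = S i.
  move=> iN.
  (* The value of [d] on the rung joining columns [i] and [i.+1] at height [j]. Around a cell the
     four values cancel, so the two column sums differ by the telescoping sum of [tau], whose
     extreme rungs vanish because [H] equals [c 0] on both horizontal sides. *)
  pose tau j := d (H (h i j)) (H (h i.+1 j)).
  have E j : (j < N.+1)%N -> d (H (h i.+1 j)) (H (h i.+1 j.+1)) =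
      d (H (h i j)) (H (h i j.+1)) + (tau j.+1 - tau j).
    move=> jN; have [k kP] := KP (h i j) (Kh i j (ltnW iN) (ltnW jN)).
    by rewrite /tau !kP; (lra || (apply: Kh; lia) || (split; apply: hh; lia)).
  rewrite /S (eq_big_nat _ _ (F2 := fun j => d (H (h i j)) (H (h i j.+1)) + (tau j.+1 - tau j))); last first.
    by move=> j /andP[_ jN]; exact: E.
  rewrite big_split /= telescope_sumr// /tau /h.
  have [_ _ H0 _] := Hc _ (itvh i (ltnW iN)); have [_ _ H0' _] := Hc _ (itvh i.+1 iN).
  have [_ _ _ H1] := Hc _ (itvh i (ltnW iN)); have [_ _ _ H1'] := Hc _ (itvh i.+1 iN).
  by rewrite mul0r divff ?gt_eqF// H0 H0' H1 H1' d0 subrr addr0.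
have SN i : (i <= N.+1)%N -> S i = S 0%N.
  by elim: i => // i IH iN; rewrite Sstep ?IH// ltnW.
have S0 : S 0%N = \sum_(0 <= j < N.+1) d (c (j%:R / N.+1%:R)) (c (j.+1%:R / N.+1%:R)).
  apply: eq_big_nat => j /andP[_ jN]; rewrite /h mul0r.
  have [-> _ _ _] := Hc _ (itvh j (ltnW jN)).
  by have [-> _ _ _] := Hc _ (itvh j.+1 jN).
rewrite -S0 -(SN N.+1 (leqnn _)) /S big1_seq// => j /andP[_].
rewrite mem_index_iota => /andP[_ jN].
rewrite /h divff ?gt_eqF//.
have [_ -> _ _] := Hc _ (itvh j (ltnW jN)).
by have [_ -> _ _] := Hc _ (itvh j.+1 jN); rewrite d0.
Qed.

End grid.

Section tree.
Context {R : realType} {T : metricType R}.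
Hypotheses (mT : metric_graph T) (sT : simply_connected T).
Context (G : model T).
Implicit Types (e f g : oedge G) (x y v : T).

Let lt0len := @len_gt0 R T G.

Definition edge_path e (a b : R) (t : R) : T := par e (a + (b - a) * clamp t).

Lemma joins_edge_path e a b : 0 <= a <= len e -> 0 <= b <= len e ->
  joins (edge_path e a b) (cedge e) (par e a) (par e b).
Proof.
move=> /andP[a0 al] /andP[b0 bl].
have seg t : 0 <= a + (b - a) * clamp t <= len e.
  have /andP[t0 t1] := clamp_itv t.
  have -> : a + (b - a) * clamp t = (1 - clamp t) * a + clamp t * b by lra.
  apply/andP; split; first by rewrite addr_ge0// mulr_ge0//; lra.
  have -> : len e = (1 - clamp t) * len e + clamp t * len e by lra.
  by rewrite lerD// ler_wpM2l//; lra.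
split=> [t|t t0|t t1|t].
- have := (subspace_continuousP _ _).1 (@par_continuous _ _ _ e) (a + (b - a) * clamp t).
  rewrite /= in_itv /= seg => /(_ isT) pc W /pc /= /nbhs_ballP[d /= d0 dW].
  have ba : 0 < 1 + `|b - a| by rewrite ltr_pwDl.
  apply/nbhs_ballP; exists (d / (1 + `|b - a|)) => /=; first by rewrite divr_gt0.
  move=> s; rewrite /ball /= ltr_pdivlMr// => st; apply: dW; last by rewrite in_itv /= seg.
  rewrite /ball /= opprD addrACA subrr add0r -mulrBr normrM.
  apply: le_lt_trans st; rewrite mulrC; apply: ler_pM => //; last lra.
  exact: clamp_lipschitz.
- by rewrite /edge_path clamp_le0// mulr0 addr0.
- by rewrite /edge_path clamp_ge1// mulr1 addrC subrK.
- by exists (a + (b - a) * clamp t) => //=; rewrite in_itv /= seg.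
Qed.

(** Null-homotopies see paths only, so the connected component has to be path connected. Being
    joined to [tgt e] off [e] propagates along each closed edge met by the branch, because such an
    edge avoids [e]. *)
Lemma branch_joined e x : branch e x -> @joined R T (~` edge e) (tgt e) x.
Proof.
move: x; apply: (@connected_edge_constant _ _ mT G (branch e)
  (@joined R T (~` edge e) (tgt e)) (tgt e)).
- exact: component_connected.
- by apply: connected_component_refl; exact: tgt_notin_edge.
- by apply: joined_refl; exact: tgt_notin_edge.
move=> g u v /connected_component_sub eu /connected_component_sub ev gu gv.
have sub := cedge_avoid ev gv.
have [[s + <-] [t + <-]] := (gu, edge_cedge gv).
rewrite /= !in_itv /= => sl tl.
by split=> /joined_trans; apply; apply: joinedS sub _;
  [exists (edge_path g s t)|exists (edge_path g t s)]; exact: joins_edge_path.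
Qed.

(* A path from [tgt e] back to [src e] off the edge [e], together with [e],
   would be a loop crossing the midpoint of [e] algebraically once. *)
Lemma src_notin_branch e : ~ branch e (src e).
Proof.
move=> /branch_joined[c' c'P]; have [_ _ _ c'S] := c'P.
have l0 := lt0len e; set l := len e in l0 *.
have cP : joins (edge_path e 0 l) (cedge e) (src e) (tgt e).
  by apply: joins_edge_path; rewrite lexx ltW.
pose c := cat_path (edge_path e 0 l) c'.
have [_ ep0 ep1 _] := cP.
have cj : joins c setT (src e) (src e).
  apply: (@joins_cat _ _ _ _ setT _ (tgt e)); last first.
    by have [? ? ? _] := c'P; split.
  by have [? ? ? _] := cP; split.
have [cc c0 c1 _] := cj.
(* [d] measures the jump of [k], the indicator of the second half of [e], between two points of the
   middle part [M]. Near the midpoint it is the difference of [k]; near every other point it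
   vanishes, since [k] is constant there or [M] is missed. This local exactness is what the grid
   lemma asks for. *)
pose M := par e @` `]l / 4, 3 * l / 4[.
pose k : T -> R := \1_(par e @` `]l / 2, l[).
pose d x y := \1_M x * \1_M y * (k y - k x).
have pinj s t : 0 < s < l -> 0 < t < l -> par e s = par e t -> s = t.
  exact: par_inj.
have kE s : 0 < s < l -> k (par e s) = (l / 2 < s :> R)%:R.
  move=> sl; rewrite /k indicE; congr (_%:R); congr nat_of_bool.
  apply/idP/idP; rewrite inE /=; last by exists s => //=; rewrite in_itv /=; lra.
  by move=> [u /= + us]; rewrite in_itv /= => ul; rewrite -(pinj _ _ _ sl us); lra.
have ME s : 0 < s < l -> M (par e s) -> l / 4 < s < 3 * l / 4.
  by move=> sl [u /= + us]; rewrite in_itv /= => ul; rewrite -(pinj _ _ _ sl us); lra.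
have Me x : M x -> edge e x.
  by move=> [s /= + <-]; rewrite in_itv /= => sl; apply: par_in_edge; rewrite -/l; lra.
have dloc (z : T) : exists2 U : set T, nbhs z U & exists k : T -> R,
     forall x y, U x -> U y -> d x y = k y - k x.
  have nU a b s : 0 <= a -> b <= l -> a < s < b -> nbhs (par e s) (par e @` `]a, b[).
    move=> a0 bl sab; apply: open_nbhs_nbhs; split; first exact: par_open.
    by exists s.
  have [[s /= + <-]|nez] := pselect (edge e z).
    rewrite in_itv /= -/l => /andP[s0 sl]; have [sl2|sl2|sl2] := ltgtP s (l / 2).
    - exists (par e @` `]0, l / 2[); first by apply: nU; lra.
      exists (cst 0) => _ _ [u /= + <-] [v /= + <-]; rewrite !in_itv /= => ul vl.
      rewrite /d !kE; try lra.
      by rewrite !ltNge !ltW ?subrr ?mulr0//; lra.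
    - exists (par e @` `]l / 2, l[); first by apply: nU; lra.
      exists (cst 0) => _ _ [u /= + <-] [v /= + <-]; rewrite !in_itv /= => ul vl.
      rewrite /d !kE; try lra.
      by have /andP[-> _] := ul; have /andP[-> _] := vl; rewrite subrr mulr0 subrr.
    - exists M; first by apply: nU; lra.
      by exists k => x y Mx My; rewrite /d !indicE !mem_set// !mul1r.
  exists (~` (par e @` `[l / 4, 3 * l / 4])).
    apply: open_nbhs_nbhs; split.
      by apply: closed_openC; apply: par_closed; rewrite -/l; lra.
    move=> [s /= + sz]; rewrite in_itv /= => sl; apply: nez; rewrite -sz.
    by exists s => //=; rewrite in_itv /= -/l; lra.
  exists (cst 0) => x y nx _; rewrite /d indicE memNset ?mul0r ?subrr//.
  move=> [s /= + sx]; rewrite in_itv /= => sl; apply: nx; rewrite -sx.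
  by exists s => //=; rewrite in_itv /=; lra.
have [_ /(_ c)] := sT; case.
- by apply: continuous_subspaceT.
- by rewrite c0// c1.
move=> H cH HP; have [N0 _ NP] := null_homotopic_sum0 dloc cH HP.
(* With [2 * K] steps the switch from [e] to [c'] at time 1/2 falls on a grid point, so [e] is run
   through in [K] steps of relative length at most 1/5. This is less than the 1/4 separating the
   midpoint from the ends of [M], so no step can cross the midpoint while starting or ending outside
   [M]. *)
pose K := (N0 + 5)%N; have K5 : (5 <= K)%N by rewrite leq_addl.
have := NP (2 * K).-1; rewrite /= => /(_ _)/wrap[|]; first by rewrite /K; lia.
rewrite prednK; last lia.
have K0 : 0 < K%:R :> R by rewrite ltr0n; lia.
rewrite (big_cat_nat (n := K))//=; last lia.
(* From time 1/2 on the loop stays off [e], hence off [M], and contributes nothing. *)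
rewrite [X in _ + X]big1_seq ?addr0; last first.
  move=> j /andP[_]; rewrite mem_index_iota => /andP[Kj _].
  rewrite /d indicE memNset ?mul0r// => /Me; rewrite /c /cat_path; case: ifP => jK.
    rewrite ep1; first exact: tgt_notin_edge.
    rewrite mulrCA natrM invfM mulVKf ?ler_pdivlMr ?mul1r ?ler_nat//.
  exact: c'S.
(* Records whether step [j] is past the midpoint. Each remaining term is an increment of [F], so the
   sum is 1, against the value 0 forced by the homotopy. *)
pose F j : R := (K%:R < 2 * j%:R :> R)%:R.
have cE j : (j <= K)%N -> c (j%:R / (2 * K)%:R) = par e (l * (j%:R / K%:R)).
  move=> jK; have jK1 : 0 <= (j%:R / K%:R : R) <= 1.
    by rewrite divr_ge0//= ler_pdivrMr// mul1r ler_nat.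
  have E : 2 * (j%:R / (2 * K)%:R) = j%:R / K%:R :> R.
    by rewrite natrM invfM mulrCA mulVKf.
  rewrite /c /cat_path ifT; first by rewrite E /edge_path clamp_id// subr0 add0r.
  by lra.
have MP (t : R) : 0 <= t <= 1 -> M (par e (l * t)) ->
    1 / 4 < t < 3 / 4 /\ k (par e (l * t)) = (1 / 2 < t :> R)%:R.
  move=> /andP[]; rewrite le_eqVlt => /predU1P[<- _ /Me|t0].
    by rewrite mulr0 => /src_notin_edge.
  rewrite le_eqVlt => /predU1P[-> /Me|t1 Mt].
    by rewrite mulr1 => /tgt_notin_edge.
  have lt : 0 < l * t < l by rewrite mulr_gt0//= gtr_pMr.
  have := ME _ lt Mt; rewrite kE// => lt4; split; first by nra.
  by congr (nat_of_bool _)%:R; apply/idP/idP; nra.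
have MN (t : R) : 1 / 4 < t < 3 / 4 -> M (par e (l * t)).
  by move=> t4; exists (l * t) => //=; rewrite in_itv /=; nra.
rewrite (eq_big_nat _ _ (F2 := fun j => F j.+1 - F j)); last first.
  move=> j /andP[_ jK]; rewrite !cE//; last exact: ltnW.
  set t := j%:R / K%:R; set t' := j.+1%:R / K%:R.
  have K5' : 0 < (K%:R^-1 : R) <= 1 / 5.
    by rewrite invr_gt0 K0 /= div1r lef_pV2 ?posrE// ler_nat.
  have tt' : t' = t + K%:R^-1 by rewrite /t' /t -addn1 natrD mulrDl div1r.
  have t0 : 0 <= t by rewrite divr_ge0.
  have t1 : t' <= 1 by rewrite ler_pdivrMr// mul1r ler_nat.
  have FE i : F i = (1 / 2 < i%:R / K%:R :> R)%:R.
    by rewrite /F ltr_pdivlMr//; congr (nat_of_bool _)%:R; apply/idP/idP; lra.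
  rewrite !FE -/t -/t'.
  have [Mt|nMt] := pselect (M (par e (l * t))); last first.
    rewrite /d indicE memNset// !mul0r.
    have nt : ~~ (1 / 4 < t < 3 / 4) by apply/negP => /MN.
    have -> : (1 / 2 < t') = (1 / 2 < t) by apply/idP/idP; lra.
    by rewrite subrr.
  have [Mt'|nMt'] := pselect (M (par e (l * t'))); last first.
    rewrite /d [X in _ * X * _]indicE memNset// mulr0 mul0r.
    have nt : ~~ (1 / 4 < t' < 3 / 4) by apply/negP => /MN.
    have -> : (1 / 2 < t') = (1 / 2 < t) by apply/idP/idP; lra.
    by rewrite subrr.
  rewrite /d !indicE !mem_set// mulr1.
  have /MP/(_ Mt)[_ ->] : 0 <= t <= 1 by lra.
  have /MP/(_ Mt')[_ ->] : 0 <= t' <= 1 by lra.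
  by rewrite /= (mul1r (_ - _)).
have F0 : F 0%N = 0 by rewrite /F mulr0 ltNge (ltW K0).
have F1 : F K = 1 by rewrite /F (_ : (_ < _) = true)//; lra.
rewrite telescope_sumr// F0 F1 subr0.
by apply/eqP; rewrite oner_eq0.
Qed.

End tree.

(** * Branches of a tree *)

Section branches.
Context {R : realType} {T : metricType R}.
Hypotheses (mT : metric_graph T) (sT : simply_connected T).
Context (G : model T).
Implicit Types (e f g : oedge G) (x y v : T).

Lemma branch_tgt e : branch e (tgt e).
Proof. by apply: connected_component_refl; exact: tgt_notin_edge. Qed.

Lemma branch_avoid e : branch e `<=` ~` edge e.
Proof. exact: connected_component_sub. Qed.

Lemma branch_obar_avoid e : branch (obar e) `<=` ~` edge e.
Proof. by rewrite -edge_obar; exact: branch_avoid. Qed.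

Lemma branch_connected e : connected (branch e).
Proof. exact: component_connected. Qed.

Lemma branch_obar_src e : branch (obar e) (src e).
Proof. by rewrite -tgt_obar; exact: branch_tgt. Qed.

Lemma sub_branch e (C : set T) u : connected C -> C `<=` ~` edge e ->
  C u -> branch e u -> C `<=` branch e.
Proof.
move=> cC Ce Cu eu v Cv; apply: connected_component_trans eu _.
exact: (connected_component_max Cu Ce cC).
Qed.

(** If the two sides met, the connected set [branch (obar e)] would be absorbed by [branch e], which
    would then contain [src e]. *)
Lemma branch_disj e x : branch e x -> branch (obar e) x -> False.
Proof.
move=> ex bx; apply: (src_notin_branch mT sT (e := e)).
have sub : branch (obar e) `<=` branch e.
  apply: (@sub_branch e _ x) => //; first exact: branch_connected.
  exact: branch_obar_avoid.
exact: sub (branch_obar_src e).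
Qed.

Lemma cedge_sub_branch e g v : ~ edge e v -> edge g v ->
  forall u, cedge g u -> branch e u -> cedge g `<=` branch e.
Proof.
by move=> ev gv u; apply: sub_branch (cedge_avoid ev gv); exact: cedge_connected.
Qed.

Lemma component_cedge (A : set T) e x y : cedge e `<=` A -> cedge e x ->
  cedge e y -> connected_component A x y.
Proof. by move=> eA ex; apply: (connected_component_max ex eA); exact: cedge_connected. Qed.

(** Propagation from [tgt e]: a closed edge other than [e] avoids [e], so it stays within one side,
    and [e] itself has its two endpoints on the two sides. *)
Lemma branch_cover e x : [\/ edge e x, branch e x | branch (obar e) x].
Proof.
suff : edge e `|` branch e `|` branch (obar e) = setT.
  by move=> /seteqP[_ /(_ x I)] [[?|?]|?]; [constructor 1|constructor 2|constructor 3].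
rewrite -subTset.
apply: (@connected_edge_constant _ _ mT G setT _ (tgt e)) => //.
- by have [] := mT.
- by left; right; exact: branch_tgt.
move=> g u v _ _ gu gv.
have [ev|nev] := pselect (edge e v).
  split=> _; first by left; left.
  have : cedge e u.
    by case: (edge_inj ev gv) gu => ->; rewrite ?cedge_obar.
  case/cedgeP => [->|->|]; [right; exact: branch_obar_src|left; right; exact: branch_tgt|].
  by left; left.
have gv' := edge_cedge gv.
have neu : ~ edge e u := cedge_avoid nev gv gu.
have nev' : ~ edge (obar e) v by rewrite edge_obar.
split=> -[[//|H]|H].
- by left; right; exact: (cedge_sub_branch nev gv gu H).
- by right; exact: (cedge_sub_branch nev' gv gu H).
- by left; right; exact: (cedge_sub_branch nev gv gv' H).
- by right; exact: (cedge_sub_branch nev' gv gv' H).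
Qed.

Lemma branch_obarP e x : ~ edge e x -> branch (obar e) x <-> ~ branch e x.
Proof.
move=> nex; split; first by move=> /[swap] /branch_disj/[apply].
by have [|//|] := branch_cover e x.
Qed.

Lemma branch_obar_vtx e x : vtx G x -> branch (obar e) x <-> ~ branch e x.
Proof. by move=> vx; apply: branch_obarP => /edge_notin_vtx. Qed.

Lemma edge_in_branch e f : edge f = edge e \/ cedge f `<=` branch e \/
  cedge f `<=` branch (obar e).
Proof.
have [ev|nev] := pselect (edge e (par f (len f / 2))).
  by left; apply: edge_eq_meet ev; exact: edge_mid.
right; have fm := edge_mid f; have fm' := edge_cedge fm.
have [//|em|em] := branch_cover e (par f (len f / 2)).
  by left; exact: (cedge_sub_branch nev fm fm' em).
by right; apply: (cedge_sub_branch _ fm fm' em); rewrite edge_obar.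
Qed.

Lemma branchS e f : cedge e `<=` branch (obar f) -> branch e (tgt f) ->
  branch f `<=` branch e.
Proof.
move=> ef et; apply: (@sub_branch e _ (tgt f)) => //; last exact: branch_tgt.
  exact: branch_connected.
by move=> x fx /edge_cedge/ef fx'; exact: branch_disj fx fx'.
Qed.

(** When [e] and [f] point towards each other their branches overlap and together cover the tree;
    the vertex [x0] outside both rules this out. *)
Lemma branch_nested x0 e f : vtx G x0 -> ~ branch e x0 -> ~ branch f x0 ->
  [\/ branch e `<=` branch f, branch f `<=` branch e | branch e `&` branch f = set0].
Proof.
move=> vx ne nf.
have be : branch (obar e) x0 by exact/branch_obar_vtx.
have disj (g h : oedge G) : branch g `<=` branch (obar h) -> branch g `&` branch h = set0.
  by move=> gh; apply/seteqP; split=> // x [/gh hx xh]; exact: branch_disj xh hx.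
have [fe|[fe|fe]] := edge_in_branch e f.
- have : f = e \/ f = obar e by apply: par_edge_inj; rewrite -[LHS]/(edge e) -fe.
  case=> fE; first by constructor 1; rewrite fE.
  by constructor 3; rewrite setIC fE; apply: disj.
- have [ef|[ef|ef]] := edge_in_branch f e.
  + by case: (@branch_avoid e _ (fe _ (edge_cedge (edge_mid f)))); rewrite ef; exact: edge_mid.
  (* The edges point towards each other: everything behind [e], in particular [x0], would lie beyond
     [f]. *)
  + exfalso; apply: nf; apply: (@branchS f (obar e)) be.
      by rewrite obarK.
    by rewrite tgt_obar; apply: ef; exact: cedge_src.
  + by constructor 2; apply: branchS ef _; apply: fe; exact: cedge_tgt.
- have [ef|[ef|ef]] := edge_in_branch f e.
  + by case: (@branch_obar_avoid e _ (fe _ (edge_cedge (edge_mid f)))); rewrite ef; exact: edge_mid.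
  + by constructor 1; apply: branchS fe _; apply: ef; exact: cedge_tgt.
  + constructor 3; rewrite setIC; apply: disj; apply: branchS; first by rewrite cedge_obar.
    by apply: fe; exact: cedge_tgt.
Qed.

End branches.

(** * Exhaustion of the graph by finite connected subgraphs *)

Section exhaustion.
Context {R : realType} {T : metricType R}.
Hypothesis mT : metric_graph T.
Context (G : model T) (x0 : T).
Hypothesis vx0 : vtx G x0.
Implicit Types (e f g : oedge G) (x y v : T).

(** The combinatorial ball of radius [n] around [x0]; [near_graph n] is the full subgraph it
    spans. *)
Fixpoint near_vtx n : set T :=
  if n is m.+1 then near_vtx m `|` [set tgt e | e in [set e : oedge G | near_vtx m (src e)]]
  else [set x0].

Definition near_edge n : set (oedge G) :=
  [set e | near_vtx n (src e) /\ near_vtx n (tgt e)].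

Definition near_graph n : set T := near_vtx n `|` \bigcup_(e in near_edge n) cedge e.

Lemma near_vtx_vtx n : near_vtx n `<=` vtx G.
Proof.
elim: n => [x /= ->//|n IH x [/IH//|[e _ <-]]]; exact: tgt_vtx.
Qed.

Lemma near_vtxW m n : (m <= n)%N -> near_vtx m `<=` near_vtx n.
Proof.
elim: n => [|n IH]; first by rewrite leqn0 => /eqP ->.
by rewrite leq_eqVlt => /predU1P[->//|/IH mn] x /mn; left.
Qed.

Lemma near_graphW m n : (m <= n)%N -> near_graph m `<=` near_graph n.
Proof.
move=> mn x [/(near_vtxW mn)|[e [se te] ex]]; first by left.
by right; exists e => //; split; exact: near_vtxW mn _ _.
Qed.

Lemma finite_near_src n : finite_set [set e : oedge G | near_vtx n (src e)].
Proof.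
have step m : finite_set (near_vtx m) -> finite_set [set e : oedge G | near_vtx m (src e)].
  move=> fm; have -> : [set e : oedge G | near_vtx m (src e)] =
      \bigcup_(v in near_vtx m) [set e : oedge G | src e = v].
    by apply/seteqP; split=> [e ve|e [v vm /= ->]//]; exists (src e).
  by apply: bigcup_finite => // v _; exact: finite_src.
apply: (step); elim: n => [|n IH] /=; first exact: finite_set1.
by rewrite finite_setU; split=> //; apply: finite_image; exact: step.
Qed.

Lemma finite_near_vtx n : finite_set (near_vtx n).
Proof.
elim: n => [|n IH] /=; first exact: finite_set1.
by rewrite finite_setU; split=> //; apply: finite_image; exact: finite_near_src.
Qed.

Lemma near_graph_compact n : compact (near_graph n).
Proof.
apply: compactU; first exact: (finite_compact (finite_near_vtx n)).
have : finite_set (near_edge n).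
  by apply: sub_finite_set (finite_near_src n) => e [].
move=> /finite_fsetP[F ->]; rewrite bigcup_fset.
by apply: bigsetU_compact => e _; exact: cedge_compact.
Qed.

Lemma near_vtx_step n x e : near_vtx n x -> cedge e x -> near_edge n.+1 e.
Proof.
move=> nx /cedgeP[xE|xE|/edge_notin_vtx[]]; last exact: near_vtx_vtx nx.
- by split; [left; rewrite -xE|right; exists e => //=; rewrite -xE].
- split; last by left; rewrite -xE.
  by right; exists (obar e); rewrite /= ?src_obar ?tgt_obar -?xE.
Qed.

Lemma near_edge_obar n e : near_edge n (obar e) <-> near_edge n e.
Proof. by rewrite /near_edge /= src_obar tgt_obar; split=> -[]. Qed.

Lemma near_edge_meet n e f x : near_edge n e -> edge e x -> edge f x -> near_edge n f.
Proof. by move=> ne ex fx; case: (edge_inj ex fx) => ->//; apply/near_edge_obar. Qed.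

Lemma near_graphP n x : near_graph n x ->
  near_vtx n x \/ exists2 e, near_edge n e & edge e x.
Proof.
case=> [|[e [se te] /cedgeP[->|->|ex]]]; [by left|by left|by left|right].
by exists e.
Qed.

Lemma near_graph_step n x e : near_graph n x -> cedge e x -> near_edge n.+1 e.
Proof.
move=> /near_graphP[nx|[f [sf tf] fx]] ex; first exact: near_vtx_step nx ex.
apply: near_edge_meet fx (edge_meet_cedge fx ex).
by split; left.
Qed.

Lemma near_graph_cover : \bigcup_n near_graph n = setT.
Proof.
rewrite -subTset; apply: (@connected_edge_constant _ _ mT G setT _ x0) => //.
- by have [] := mT.
- by exists 0%N => //; left.
move=> g u v _ _ gu /edge_cedge gv; split=> -[n _ nx].
  by exists n.+1 => //; right; exists g => //; exact: near_graph_step nx gu.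
by exists n.+1 => //; right; exists g => //; exact: near_graph_step nx gv.
Qed.

Lemma near_graph_nbhs n x : near_graph n x -> \forall y \near x, near_graph n.+1 y.
Proof.
move=> nx; apply: filterS (near_cedge mT G x) => y [->|[g gx gy]].
  exact: near_graphW nx.
by right; exists g; [exact: near_graph_step nx gx|exact: edge_cedge].
Qed.

(** Each [near_graph n] lies in the interior of the next one and together they cover the space, so
    compactness picks a single index. *)
Lemma compact_near_graph K : compact K -> exists n, K `<=` near_graph n.
Proof.
move=> /compact_near_coveringP cK.
have [|n _ nK] := cK nat \oo near_graph _.
- move=> x _; have [n _ nx] : (\bigcup_n near_graph n) x by rewrite near_graph_cover.
  exists (near_graph n.+1, [set m | (n.+1 <= m)%N]) => /=.
    by split; [exact: near_graph_nbhs|exists n.+1].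
  by move=> [y m] /= [ny nm]; exact: near_graphW nm _ ny.
- by exists n; exact: nK n (leqnn n).
Qed.

Lemma countable_oedge : countable [set: oedge G].
Proof.
rewrite (_ : setT = \bigcup_n [set e : oedge G | near_vtx n (src e)]).
  apply: bigcup_countable => // n _; apply: finite_set_countable.
  exact: finite_near_src.
apply/esym; rewrite -subTset => e _.
have [n _ /near_graphP[nx|[f _]]] : (\bigcup_n near_graph n) (src e).
  by rewrite near_graph_cover.
  by exists n.
by move=> /src_notin_edge.
Qed.

Lemma near_graph_connected n : connected (near_graph n).
Proof.
have x0n m : near_graph m x0 by left; exact: (@near_vtxW 0).
have vcon m : forall k, (k <= m)%N -> near_vtx k `<=` connected_component (near_graph m) x0.
  elim=> [_ x ->|k IH km x /=].
    exact: connected_component_refl.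
  move=> [|[e /= se <-]]; first exact: IH (ltnW km) _.
  apply: connected_component_trans (IH (ltnW km) _ se) _.
  apply: (component_cedge _ (cedge_src e) (cedge_tgt e)).
  move=> y ey; right; exists e => //; split.
    exact: near_vtxW (ltnW km) _ se.
  by apply: (near_vtxW km); right; exists e.
suff -> : near_graph n = connected_component (near_graph n) x0.
  exact: component_connected.
apply/seteqP; split; last exact: connected_component_sub.
move=> x [|[e ne ex]]; first exact: vcon.
have [se _] := ne.
apply: connected_component_trans (vcon n n (leqnn n) _ se) _.
apply: (component_cedge _ (cedge_src e) ex).
by move=> y ey; right; exists e.
Qed.

(** An end escapes the finite subgraph through one of the edges [X] leaving the ball. The subgraph,
    these edges and the branches beyond them fill the whole graph by propagation along closed edges;
    if the end lay beyond none of them, a point of the component it selects would be nowhere. *)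
Lemma end_exit (y : ends T) n : exists2 e : oedge G,
  near_graph n `<=` branch (obar e) & branch_ends e y.
Proof.
apply: contrapT => nex.
pose X := [set e : oedge G | near_vtx n (src e) /\ ~ near_vtx n (tgt e)].
have XB e : X e -> near_graph n `<=` branch (obar e).
  move=> [se te]; apply: (@sub_branch _ _ _ (obar e) _ (src e)); last 2 first.
  - by left.
  - exact: branch_obar_src.
  - exact: near_graph_connected.
  rewrite edge_obar => x /near_graphP[/near_vtx_vtx vx /edge_notin_vtx//|[f nf fx ex]].
  by have [_ /te] := near_edge_meet nf fx ex.
have XN e : X e -> ~ branch_ends e y by move=> Xe ye; apply: nex; exists e => //; exact: XB.
have [yc ym _] := svalP y.
(* The end is tested one level further out: [near_graph n.+1] contains the closed exit edges, so the
   selected component avoids them and lies in a branch as soon as it meets it. *)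
have [z nz zE] := yc _ (@near_graph_compact n.+1).
have zX e : X e -> ~ edge e z /\ ~ branch e z.
  move=> Xe; have [se te] := Xe.
  have ne : near_edge n.+1 e by apply: near_vtx_step se (cedge_src e).
  have nez : ~ edge e z by move=> ez; apply: nz; right; exists e => //; exact: edge_cedge.
  split=> // bz; apply: (XN e Xe); exists (near_graph n.+1); first exact: near_graph_compact.
  rewrite zE; apply: (@sub_branch _ _ _ e _ z) => //.
  - exact: component_connected.
  - move=> u /connected_component_sub nu /edge_cedge eu; apply: nu.
    by right; exists e.
  - exact: connected_component_refl.
suff /seteqP[_ /(_ z I)] : near_graph n `|` \bigcup_(e in X) (edge e `|` branch e) = setT.
  case=> [/(near_graphW (leqnSn n))//|[e Xe]].
  by have [? ?] := zX e Xe; case.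
rewrite -subTset.
suff step g u : (near_graph n `|` \bigcup_(e in X) (edge e `|` branch e)) u -> cedge g u ->
    cedge g `<=` near_graph n `|` \bigcup_(e in X) (edge e `|` branch e).
  apply: (@connected_edge_constant _ _ mT G setT _ x0) => //.
  - by have [] := mT.
  - by left; left; exact: (@near_vtxW 0).
  move=> g u v _ _ gu /edge_cedge gv; split=> H; first exact: step H gu _ gv.
  exact: step H gv _ gu.
have srcX f : near_vtx n (src f) ->
    cedge f `<=` near_graph n `|` \bigcup_(e in X) (edge e `|` branch e).
  move=> nf; have [tf|tf] := pselect (near_vtx n (tgt f)).
    by move=> x fx; left; right; exists f.
  have Xf : X f by [].
  move=> x /cedgeP[->|->|fx]; first by left; left.
    by right; exists f => //; right; exact: branch_tgt.
  by right; exists f => //; left.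
case=> [/near_graphP[nu|[f nf fu]]|[f Xf [fu|fu]]] gu.
- move: gu nu => /cedgeP[->|->|/edge_notin_vtx gu /near_vtx_vtx//]; first exact: srcX.
  by rewrite -src_obar -cedge_obar; exact: srcX.
- have ng := near_edge_meet nf fu (edge_meet_cedge fu gu).
  by move=> x gx; left; right; exists g.
- have gE : cedge g = cedge f.
    by case: (edge_inj fu (edge_meet_cedge fu gu)) => ->; rewrite ?cedge_obar.
  by rewrite gE; apply: srcX; case: Xf.
- have [gf|nf] := pselect (edge f (par g (len g / 2))).
    have gE : cedge g = cedge f.
      by case: (edge_inj gf (edge_mid g)) => ->; rewrite ?cedge_obar.
    by rewrite gE; apply: srcX; case: Xf.
  move=> x gx; right; exists f => //; right.
  exact: (cedge_sub_branch nf (edge_mid g) gu fu).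
Qed.

End exhaustion.

(** * Ends of a tree *)

Section branch_ends_theory.
Context {R : realType} {T : metricType R}.
Hypotheses (mT : metric_graph T) (sT : simply_connected T).
Context (G : model T).
Implicit Types (e f g : oedge G) (y z : ends T).

Lemma end_nonempty y K : compact K -> exists x, sval y K x.
Proof.
move=> cK; have [yc _ _] := svalP y; have [x nx yE] := yc _ cK.
by exists x; rewrite yE; exact: connected_component_refl.
Qed.

Lemma end_meet y K L : compact K -> compact L -> exists2 x, sval y K x & sval y L x.
Proof.
move=> cK cL; have cKL := compactU cK cL; have [x yx] := end_nonempty y cKL.
have [_ ym _] := svalP y.
by exists x; [exact: ym yx|exact: ym yx].
Qed.

Lemma branch_ends_open e : open (branch_ends e : set (ends T)).
Proof. by move=> y [K cK yK]; exists K => // z /= zE; exists K => //; rewrite zE. Qed.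

Lemma branch_endsS e f : branch e `<=` branch f -> branch_ends e `<=` branch_ends f.
Proof. by move=> ef y [K cK yK]; exists K => // x /yK/ef. Qed.

Lemma branch_ends_disj e f : branch e `&` branch f = set0 ->
  branch_ends e `&` branch_ends f = set0.
Proof.
move=> /seteqP[ef _]; apply/seteqP; split=> // y [[K cK yK] [L cL yL]].
by have [x /yK ex /yL fx] := end_meet y cK cL; exact: (ef x).
Qed.

(** The closed edge is compact, and the component of its complement selected by an end is connected
    and off [e], hence on one side of it. *)
Lemma branch_ends_obar e : branch_ends (obar e) = ~` branch_ends e.
Proof.
apply/seteqP; split=> y.
  move=> ye ey; have : (branch_ends e `&` branch_ends (obar e)) y by [].
  rewrite branch_ends_disj//; apply/seteqP; split=> // x [ex].
  exact: (branch_disj mT sT ex).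
move=> ney; have [yc _ _] := svalP y; have [x nx yE] := yc _ (cedge_compact (e := e)).
have sub f : edge f = edge e -> branch f x -> branch_ends f y.
  move=> fe fx; exists (cedge e); first exact: cedge_compact.
  rewrite yE; apply: (@sub_branch _ _ _ f _ x) => //.
  - exact: component_connected.
  - by rewrite fe => u /connected_component_sub nu /edge_cedge.
  - exact: connected_component_refl.
have [/edge_cedge//|/sub|/sub] := branch_cover mT e x; first by move=> /(_ erefl).
by apply; exact: edge_obar.
Qed.

(** Put the compact set defining the neighbourhood inside a finite subgraph and let the end exit
    through [f]. The branch of [f] is connected and misses the compact set, so all ends beyond [f]
    select the same component. *)
Lemma branch_ends_base (x0 : T) (U : set (ends T)) y : vtx G x0 -> open U -> U y ->
  exists f : oedge G, [/\ ~ branch f x0, branch_ends f y & branch_ends f `<=` U].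
Proof.
move=> vx oU /oU[K cK KU].
have [n Kn] := compact_near_graph mT vx cK.
have [f nf fy] := end_exit mT vx y n.
exists f; split => //.
  by move=> fx; apply: (branch_disj mT sT fx); apply: nf; left; exact: (@near_vtxW _ _ _ _ 0).
have fK : branch f `<=` ~` K.
  by move=> x fx /Kn/nf; exact: (branch_disj mT sT fx).
have yKE z : branch_ends f z -> forall x, branch f x -> sval z K = connected_component (~` K) x.
  move=> [L cL zL] x fx; have [zc _ _] := svalP z.
  have [w /[swap] /zL fw] := end_meet z cK cL.
  have [u nu ->] := zc _ cK => /same_connected_component ->.
  apply: same_connected_component.
  by apply: (connected_component_max fw fK) => //; exact: branch_connected.
move=> z fz; apply: KU => /=.
by rewrite (yKE z fz (tgt f) (branch_tgt f)) (yKE y fy (tgt f) (branch_tgt f)).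
Qed.

Context (o : ends T).

Lemma measurable_branch_ends e : measurable (branch_ends e : set (borel o)).
Proof. by apply: sub_sigma_algebra; exact: branch_ends_open. Qed.

(* The branches away from a vertex form a countable base of the space of ends
   in which any two members are nested or disjoint. *)
Lemma eq_measure_branch_ends (x0 : T) (m1 m2 : {measure set (borel o) -> \bar R}) :
  vtx G x0 -> (m1 setT < +oo)%E -> m1 setT = m2 setT ->
  (forall f, ~ branch f x0 -> m1 (branch_ends f) = m2 (branch_ends f)) ->
  forall A, measurable A -> m1 A = m2 A.
Proof.
move=> vx m1T m12T m12 A mA.
pose P : set (set (borel o)) := [set B | [\/ B = setT, B = set0 |
  exists2 f : oedge G, ~ branch f x0 & B = branch_ends f]].
have PI : setI_closed P.
  move=> B C [->|->|[e ne ->]]; rewrite ?setTI// ?set0I; first by constructor 2.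
  case=> [->|->|[f nf ->]]; rewrite ?setIT ?setI0; [by constructor 3; exists e|by constructor 2|].
  have [ef|fe|ef] := branch_nested mT sT vx ne nf.
  - by constructor 3; exists e => //; apply/setIidPl; exact: branch_endsS.
  - by constructor 3; exists f => //; apply/setIidPr; exact: branch_endsS.
  - by constructor 2; exact: branch_ends_disj.
have PA : <<s P >> A.
  move: A mA; apply: smallest_sub; first exact: smallest_sigma_algebra.
  move=> U oU.
  (* Unsuitable edges contribute the empty set, so that the union runs over the whole countable type
     of edges. *)
  pose F (f : oedge G) : set (borel o) :=
    if `[< ~ branch f x0 /\ branch_ends f `<=` U >] then branch_ends f else set0.
  have -> : U = \bigcup_f F f.
    apply/seteqP; split=> [y Uy|y [f _]].
      have [f [nf fy fU]] := branch_ends_base vx oU Uy.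
      by exists f => //; rewrite /F; case: asboolP => // -[].
    by rewrite /F; case: asboolP => // -[_]; apply.
  apply: (@countable_bigcupT_measurable _ (g_sigma_algebraType P)).
    exact: countable_oedge mT _ x0 vx.
  move=> f; rewrite /F; case: asboolP => [[nf _]|_]; last exact: measurable0.
  by apply: sub_sigma_algebra; constructor 3; exists f.
apply: (@g_sigma_algebra_measure_unique _ _ _ P _ (fun=> setT)) => //.
- move=> B [->|->|[f _ ->]]; [exact: measurableT|exact: measurable0|].
  exact: measurable_branch_ends.
- by move=> _; constructor 1.
- by rewrite bigcup_const.
- by move=> B [->|->|[f nf ->]]; rewrite ?measure0//; exact: m12.
Qed.

End branch_ends_theory.

(** * Sums of families of reals *)

Section real_sums.
Context {R : realType} {T : metricType R} (G : model T).
Implicit Types (A : set (oedge G)) (f g : oedge G -> R).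

Lemma esumZl A (a : oedge G -> \bar R) (c : R) : 0 <= c -> (forall i, (0 <= a i)%E) ->
  (\esum_(i in A) (c%:E * a i) = c%:E * \esum_(i in A) a i)%E.
Proof.
have le (b : oedge G -> \bar R) k : 0 <= k -> (forall i, (0 <= b i)%E) ->
    (\esum_(i in A) (k%:E * b i) <= k%:E * \esum_(i in A) b i)%E.
  move=> k0 b0; apply: ge_ereal_sup => _ [X [finX XA] <-].
  rewrite -ge0_mule_fsumr//; apply: lee_wpmul2l; first by rewrite lee_fin.
  by apply: ereal_sup_ubound; exists X.
rewrite le_eqVlt => /predU1P[<- a0|c0 a0].
  by rewrite mul0e; apply: esum1 => i _; rewrite mul0e.
apply/eqP; rewrite eq_le; apply/andP; split; first by apply: le => //; exact: ltW.
rewrite -lee_pdivlMl//.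
apply: (le_trans _ (le (fun i => c%:E * a i)%E c^-1 _ _)).
- by apply: le_esum => i Ai; rewrite muleA -EFinM mulVf ?gt_eqF// mul1e.
- by rewrite invr_ge0 ltW.
- by move=> i; rewrite mule_ge0// lee_fin ltW.
Qed.

Definition rsummable A f : Prop := (\esum_(e in A) `|f e|%:E < +oo)%E.

Lemma rsummable_le A f g : (forall e, A e -> `|f e| <= g e) ->
  rsummable A g -> rsummable A f.
Proof.
move=> fg; apply: le_lt_trans; apply: le_esum => e Ae; rewrite lee_fin.
exact: le_trans (fg e Ae) (ler_norm _).
Qed.

Lemma rsummableD A f g : rsummable A f -> rsummable A g ->
  rsummable A (fun e => f e + g e).
Proof.
move=> sf sg; apply: le_lt_trans (lte_add_pinfty sf sg).
rewrite -esumD//; first by apply: le_esum => e _; rewrite -EFinD lee_fin ler_normD.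
all: by move=> e _; rewrite lee_fin.
Qed.

Lemma rsummableZ A f c : rsummable A f -> rsummable A (fun e => c * f e).
Proof.
move=> sf; rewrite /rsummable (eq_esum (b := fun e => (`|c|%:E * `|f e|%:E)%E)); last first.
  by move=> e _; rewrite normrM EFinM.
rewrite esumZl//.
by rewrite lte_mul_pinfty// lee_fin.
Qed.

Lemma rsumE A f : rsum A f =
  fine (\esum_(e in A) ((EFin \o f)^\+ e)%E) - fine (\esum_(e in A) ((EFin \o f)^\- e)%E).
Proof.
rewrite /rsum; congr (fine _ - fine _); apply: eq_esum => e _.
  by rewrite funeposE /= EFin_max.
by rewrite funenegE /= EFin_max.
Qed.

Lemma esum_fin A f : (forall e, 0 <= f e) -> rsummable A f ->
  \esum_(e in A) (f e)%:E \is a fin_num.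
Proof.
move=> f0 sf; rewrite ge0_fin_numE; last by apply: esum_ge0 => e _; rewrite lee_fin.
by apply: le_lt_trans sf; apply: le_esum => e _; rewrite lee_fin ler_norm.
Qed.

(** Any decomposition into nonnegative summable families computes [rsum], not just the positive and
    negative parts of its definition. Linearity follows, since the positive part of a sum is not the
    sum of the positive parts. *)
Lemma rsumB A f g : (forall e, 0 <= f e) -> (forall e, 0 <= g e) ->
  rsummable A f -> rsummable A g ->
  rsum A (fun e => f e - g e) =
  fine (\esum_(e in A) (f e)%:E) - fine (\esum_(e in A) (g e)%:E).
Proof.
move=> f0 g0 sf sg.
have sf' : summable A (EFin \o f) by exact: sf.
have sg' : summable A (EFin \o g) by exact: sg.
have := esumB sf' sg' (fun e _ => f0 e) (fun e _ => g0 e).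
have eqD : ((EFin \o f) \- (EFin \o g) = EFin \o (fun e => f e - g e)%R)%E by [].
rewrite eqD => H; rewrite rsumE -fineB.
- by rewrite H fineB//; exact: esum_fin.
- rewrite -eqD; have := summable_funepos (summableB sf' sg'); rewrite summableE.
  by rewrite (eq_esum (b := ((EFin \o f) \- (EFin \o g))^\+)%E)// => e _; rewrite gee0_abs.
- rewrite -eqD; have := summable_funeneg (summableB sf' sg'); rewrite summableE.
  by rewrite (eq_esum (b := ((EFin \o f) \- (EFin \o g))^\-)%E)// => e _; rewrite gee0_abs.
Qed.

Lemma rsum_ge0E A f : (forall e, 0 <= f e) -> rsummable A f ->
  rsum A f = fine (\esum_(e in A) (f e)%:E).
Proof.
move=> f0 sf; rewrite (_ : rsum A f = rsum A (fun e => f e - 0)).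
  rewrite rsumB//; first by rewrite (esum1 (a := fun=> 0%E))//= subr0.
  by rewrite /rsummable esum1// => e _; rewrite normr0.
by congr rsum; apply/funext => e; rewrite subr0.
Qed.

Let pos (x : R) := Num.max x 0.

Let pos_ge0 x : 0 <= pos x. Proof. by rewrite /pos le_max lexx orbT. Qed.

Let posB x : x = pos x - pos (- x).
Proof. by rewrite /pos; case: (leP x 0) => ?; case: (leP (- x) 0) => ?; lra. Qed.

Let pos_le x : `|pos x| <= `|x|.
Proof. by rewrite ger0_norm// /pos ge_max ler_norm normr_ge0. Qed.

Let rsummable_pos A f : rsummable A f -> rsummable A (fun e => pos (f e)).
Proof.
move=> sf; apply: (@rsummable_le _ _ (fun e => `|f e|)).
  by move=> e _; exact: pos_le.
by rewrite /rsummable; under eq_esum do rewrite normr_id.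
Qed.

Lemma rsummableN A f : rsummable A f -> rsummable A (fun e => - f e).
Proof. by rewrite /rsummable; under [X in _ -> (X < _)%E]eq_esum do rewrite normrN. Qed.

Let fine_esumD A f g : (forall e, 0 <= f e) -> (forall e, 0 <= g e) ->
  rsummable A f -> rsummable A g ->
  fine (\esum_(e in A) (f e + g e)%:E) =
  fine (\esum_(e in A) (f e)%:E) + fine (\esum_(e in A) (g e)%:E).
Proof.
move=> f0 g0 sf sg; rewrite -fineD ?esum_fin//; congr fine.
by rewrite -esumD// => e _; rewrite lee_fin.
Qed.

Lemma rsumD A f g : rsummable A f -> rsummable A g ->
  rsum A (fun e => f e + g e) = rsum A f + rsum A g.
Proof.
move=> sf sg.
have pf := rsummable_pos sf; have pg := rsummable_pos sg.
have nf := rsummable_pos (rsummableN sf); have ng := rsummable_pos (rsummableN sg).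
have -> : rsum A (fun e => f e + g e) = rsum A (fun e =>
    (pos (f e) + pos (g e)) - (pos (- f e) + pos (- g e))).
  by congr rsum; apply/funext => e; rewrite {1}(posB (f e)) {1}(posB (g e)) opprD addrACA.
rewrite rsumB; last 4 first.
- by move=> e; rewrite addr_ge0.
- by move=> e; rewrite addr_ge0.
- exact: rsummableD.
- exact: rsummableD.
rewrite (fine_esumD _ _ pf pg)// (fine_esumD _ _ nf ng)//.
by rewrite /rsum opprD addrACA.
Qed.

Lemma rsumZ A f c : rsummable A f -> rsum A (fun e => c * f e) = c * rsum A f.
Proof.
move=> sf.
have scale (k : R) (h : oedge G -> R) : 0 <= k -> (forall e, 0 <= h e) ->
    rsummable A h ->
    fine (\esum_(e in A) (k * h e)%:E) = k * fine (\esum_(e in A) (h e)%:E).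
  move=> k0 h0 sh; under eq_esum do rewrite EFinM.
  rewrite esumZl//.
  by rewrite fineM// esum_fin.
have pf := rsummable_pos sf; have nf := rsummable_pos (rsummableN sf).
have nonneg k : 0 <= k -> rsum A (fun e => k * f e) = k * rsum A f.
  move=> k0.
  have -> : rsum A (fun e => k * f e) =
      rsum A (fun e => k * pos (f e) - k * pos (- f e)).
    by congr rsum; apply/funext => e; rewrite {1}(posB (f e)) mulrBr.
  rewrite rsumB; try by [move=> e; rewrite mulr_ge0|exact: rsummableZ].
  rewrite (scale k _ k0 (fun e => pos_ge0 _) pf).
  by rewrite (scale k _ k0 (fun e => pos_ge0 _) nf) -mulrBr.
have opp (h : oedge G -> R) : rsum A (fun e => - h e) = - rsum A h.
  by rewrite /rsum opprB; congr (_ - _); under eq_esum do rewrite opprK.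
have [c0|c0] := leP 0 c; first exact: nonneg.
rewrite (_ : (fun e => c * f e) = (fun e => - (- c * f e))); last first.
  by apply/funext => e; rewrite mulNr opprK.
by rewrite opp nonneg ?oppr_ge0 ?ltW// mulNr opprK.
Qed.

Lemma eq_rsum A f g : (forall e, A e -> f e = g e) -> rsum A f = rsum A g.
Proof. by move=> fg; rewrite /rsum; congr (fine _ - fine _); apply: eq_esum => e /fg ->. Qed.

Lemma rsum_eq0 A f : (forall e, A e -> f e = 0) -> rsum A f = 0.
Proof.
move=> f0; rewrite /rsum !esum1 ?subrr// => e /f0 ->; by rewrite ?oppr0 maxxx.
Qed.

Lemma rsum_set1 A f e : A e -> (forall e', A e' -> e' != e -> f e' = 0) -> rsum A f = f e.
Proof.
move=> Ae f0.
have one (h : R -> R) : h 0 = 0 -> (forall x, 0 <= h x) ->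
    fine (\esum_(i in A) (h (f i))%:E) = h (f e).
  move=> h0 hp; rewrite (esumID [set e]); last by move=> i _; rewrite lee_fin.
  rewrite (_ : A `&` [set e] = [set e]); last by apply/setIidPr => _ ->.
  rewrite esum_set1 ?lee_fin// esum1 ?adde0//.
  by move=> i [Ai /eqP ie]; rewrite f0// h0.
rewrite /rsum (one pos) ?(one (fun x => pos (- x))) -?posB//.
  by rewrite /pos oppr0 maxxx.
by rewrite /pos maxxx.
Qed.

Lemma rsum_eq0P A f : (forall e, 0 <= f e) -> rsummable A f -> rsum A f = 0 ->
  forall e, A e -> f e = 0.
Proof.
move=> f0 sf; rewrite rsum_ge0E// => s0 e Ae; apply/eqP; rewrite eq_le f0 andbT.
have s0E : (\esum_(e in A) (f e)%:E = 0)%E by rewrite -[LHS]fineK ?esum_fin// s0.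
suff : ((f e)%:E <= \esum_(e in A) (f e)%:E)%E by rewrite s0E lee_fin.
apply: esum_ge; exists [set e].
  by split => // _ ->.
by rewrite fsbig_set1.
Qed.

End real_sums.

(** * Square-summable forms *)

Section forms.
Context {R : realType} {T : metricType R}.
Hypothesis mT : metric_graph T.
Context (G : model T).
Implicit Types (e f : oedge G) (w h : oedge G -> R) (v x : T) (a b : R).

Let lt0len := @len_gt0 R T G.

Lemma coef_obar w e : C1 w -> coef w (obar e) = - coef w e.
Proof. by move=> cw; rewrite /coef cw len_obar mulNr. Qed.

Lemma coef_lin w w' a b e :
  coef (fun e => a * w e + b * w' e) e = a * coef w e + b * coef w' e.
Proof. by rewrite /coef mulrDl !mulrA. Qed.

Lemma C1_lin w w' a b : C1 w -> C1 w' -> C1 (fun e => a * w e + b * w' e).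
Proof. by move=> cw cw' e; rewrite cw cw' !mulrN opprD. Qed.

Definition prod_density w w' : oedge G -> R := fun e => coef w e * coef w' e * len e.

Lemma L2_square w : C1_L2 w -> rsummable (ori G) (prod_density w w).
Proof.
move=> [_]; apply: le_lt_trans; apply: le_esum => e _; rewrite lee_fin.
by rewrite /prod_density -expr2 ger0_norm// mulr_ge0 ?sqr_ge0// ltW.
Qed.

(** The bound |ab| <= a^2 + b^2 makes the pairing converge absolutely, hence bilinear, on
    square-summable forms. *)
Lemma L2_prod w w' : C1_L2 w -> C1_L2 w' -> rsummable (ori G) (prod_density w w').
Proof.
move=> /L2_square sw /L2_square sw'.
apply: rsummable_le (rsummableD sw sw') => e _.
rewrite /prod_density -mulrDl normrM [`|len e|]gtr0_norm//.
apply: ler_wpM2r; first exact: ltW.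
rewrite ler_norml; apply/andP; split; nra.
Qed.

Lemma C1_L2_lin w w' a b : C1_L2 w -> C1_L2 w' -> C1_L2 (fun e => a * w e + b * w' e).
Proof.
move=> lw lw'; split; first by apply: C1_lin; [case: lw|case: lw'].
have s : rsummable (ori G) (fun e => a ^+ 2 * prod_density w w e +
    b ^+ 2 * prod_density w' w' e + 2 * a * b * prod_density w w' e).
  by apply: rsummableD; [apply: rsummableD|]; apply: rsummableZ;
    [exact: L2_square|exact: L2_square|exact: L2_prod].
apply: le_lt_trans s; apply: le_esum => e _; rewrite lee_fin.
apply: le_trans (ler_norm _); rewrite coef_lin /prod_density.
by rewrite le_eqVlt; apply/orP; left; apply/eqP; lra.
Qed.

Lemma pairingC w w' : pairing w w' = pairing w' w.
Proof. by apply: eq_rsum => e _; rewrite (mulrC (coef w e)). Qed.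

Lemma pairing_lin w w' h a b : C1_L2 w -> C1_L2 w' -> C1_L2 h ->
  pairing (fun e => a * w e + b * w' e) h = a * pairing w h + b * pairing w' h.
Proof.
move=> lw lw' lh; rewrite /pairing -!rsumZ; [|exact: L2_prod..].
rewrite -rsumD; try by apply: rsummableZ; exact: L2_prod.
by apply: eq_rsum => e _; rewrite coef_lin; lra.
Qed.

Lemma sqnormE w : C1_L2 w -> sqnorm w = (pairing w w)%:E.
Proof.
move=> lw; rewrite /pairing rsum_ge0E.
- rewrite fineK; first by apply: eq_esum => e _; rewrite expr2.
  by apply: esum_fin (L2_square lw) => e; rewrite /prod_density -expr2 mulr_ge0 ?sqr_ge0// ltW.
- by move=> e; rewrite -expr2 mulr_ge0 ?sqr_ge0// ltW.
- exact: L2_square.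
Qed.

Lemma pairing_ge0 w : C1_L2 w -> 0 <= pairing w w.
Proof.
move=> lw; rewrite -lee_fin -sqnormE//; apply: esum_ge0 => e _.
by rewrite lee_fin mulr_ge0 ?sqr_ge0// ltW.
Qed.

Lemma pairing_eq0 w : C1_L2 w -> pairing w w = 0 -> forall e, coef w e = 0.
Proof.
move=> lw w0.
have oriw e : ori G e -> coef w e = 0.
  move=> oe; have := rsum_eq0P _ (L2_square lw) w0 oe.
  rewrite /prod_density => /(_ _)/wrap[|/eqP].
    by move=> f; rewrite -expr2 mulr_ge0 ?sqr_ge0// ltW.
  by rewrite mulf_eq0 (gt_eqF (lt0len e)) orbF -expr2 sqrf_eq0 => /eqP.
move=> e; have [|noe] := pselect (ori G e); first exact: oriw.
have /oriw : ori G (obar e) by apply/ori_obar.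
by rewrite coef_obar; [move/eqP; rewrite oppr_eq0 => /eqP|case: lw].
Qed.

(** Antisymmetry turns incoming edges into reversed outgoing ones, which removes the reference
    orientation; a loop at [v] occurs in both directions and cancels. *)
Lemma dstarE w v : C1 w ->
  dstar w v = - \sum_(e \in [set e | src e = v]) coef w e.
Proof.
move=> cw; have fv := finite_src mT G v.
rewrite (fsbigID (ori G))//= opprD addrC /dstar; congr (_ - _); last first.
  by apply: eq_fsbigl; rewrite setIC.
rewrite -mulN1r mulr_fsumr.
rewrite (reindex_fsbig (@obar _ _ G) ([set e | src e = v] `&` ~` ori G)).
  by apply: eq_fsbigr => e _; rewrite coef_obar// mulN1r.
split.
- by move=> e [/= ev noe]; split; [exact/ori_obar|rewrite /= tgt_obar].
- by move=> e f _ _ /(congr1 (@obar _ _ G)); rewrite !obarK.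
- move=> e [oe /= ev]; exists (obar e); last by rewrite obarK.
  by split; [rewrite /= src_obar|move/ori_obar].
Qed.

Lemma dstar_lin w w' a b v : C1 w -> C1 w' ->
  dstar (fun e => a * w e + b * w' e) v = a * dstar w v + b * dstar w' v.
Proof.
move=> cw cw'; rewrite !dstarE//; last exact: C1_lin.
rewrite !mulrN -opprD !mulr_fsumr -fsbig_split; last exact: finite_src.
by congr (- _); apply: eq_fsbigr => e _; rewrite coef_lin.
Qed.

Lemma harmonic_lin w w' a b : Defs.harmonic w -> Defs.harmonic w' ->
  Defs.harmonic (fun e => a * w e + b * w' e).
Proof.
move=> [lw hw] [lw' hw']; split; first exact: C1_L2_lin.
move=> v vv; rewrite dstar_lin ?hw ?hw' ?mulr0 ?addr0//; by [case: lw|case: lw'].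
Qed.

(* First variation of the energy at its minimum. *)
Lemma min_dirac_form_orth x w h : min_dirac_form x w -> Defs.harmonic h -> pairing w h = 0.
Proof.
move=> [[lw dw] minw] [lh dh]; apply/eqP; apply: contrapT => /negP n0.
pose A := pairing w h; pose B := pairing h h.
have B0 : 0 <= B by exact: pairing_ge0.
have quad t : 0 <= 2 * t * A + t ^+ 2 * B.
  have lwt : C1_L2 (fun e => 1 * w e + t * h e) by exact: C1_L2_lin.
  have := minw (fun e => 1 * w e + t * h e); rewrite !sqnormE// lee_fin.
  have -> : pairing (fun e => 1 * w e + t * h e) (fun e => 1 * w e + t * h e) =
      pairing w w + (2 * t * A + t ^+ 2 * B).
    rewrite pairing_lin// [pairing w _]pairingC [pairing h _]pairingC !pairing_lin//.
    by rewrite [pairing h w]pairingC -/A -/B; lra.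
  rewrite lerDl; apply; split => // v vv.
  by rewrite dstar_lin ?dw ?dh// ?mul1r ?mulr0 ?addr0//; by [case: lw|case: lh].
have B1 : 0 < B + 1 by lra.
(* Near the minimum of the quadratic; [B + 1] replaces [B] so that the choice also makes sense when
   [B] is zero. *)
have := quad (- A / (B + 1)); apply/negP; rewrite -ltNge.
have -> : 2 * (- A / (B + 1)) * A + (- A / (B + 1)) ^+ 2 * B =
    - (A ^+ 2 * (B + 2) / (B + 1) ^+ 2).
  by field; lra.
rewrite oppr_lt0 divr_gt0// ?exprn_gt0// mulr_gt0//; last lra.
by rewrite lt_neqAle sqr_ge0 andbT eq_sym sqrf_eq0.
Qed.

Lemma obar_neqb e : (obar e == e) = false.
Proof. by apply/eqP; exact: obar_neq. Qed.

Lemma coef_de e f : coef (de e) f = (f == e)%:R - (f == obar e)%:R.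
Proof.
rewrite /coef /de; case: eqVneq => [->|_].
  by rewrite eq_sym obar_neqb subr0 divff// gt_eqF.
case: eqVneq => [->|_]; last by rewrite mul0r subrr.
by rewrite len_obar mulNr divff ?sub0r// gt_eqF.
Qed.

Lemma C1_de e : C1 (de e).
Proof.
move=> f; rewrite /de (can2_eq (@obarK _ _ G) (@obarK _ _ G)).
rewrite (inj_eq (can_inj (@obarK _ _ G))).
by case: (eqVneq f e) => [->|_]; rewrite ?[e == _]eq_sym ?obar_neqb//; case: ifP; rewrite ?opprK ?oppr0.
Qed.

Lemma L2_de e : C1_L2 (de e).
Proof.
split; first exact: C1_de.
have fin : finite_set [set e; obar e] by rewrite finite_setU; split; exact: finite_set1.
rewrite /sqnorm (esumID [set e; obar e]); last first.
  by move=> f _; rewrite lee_fin mulr_ge0 ?sqr_ge0// ltW.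
rewrite [X in (_ + X)%E]esum1 ?adde0; last first.
  move=> f [_ /not_orP[/eqP/negbTE fe /eqP/negbTE fe']].
  by rewrite coef_de fe fe' subrr expr0n mul0r.
rewrite esum_fset; first by rewrite fsumEFin ?ltry//; exact: finite_setIr.
  exact: finite_setIr.
by move=> f _; rewrite lee_fin mulr_ge0 ?sqr_ge0// ltW.
Qed.

Lemma pairing_de e h : C1 h -> pairing (de e) h = coef h e * len e.
Proof.
move=> ch; have [oe|noe] := pselect (ori G e).
  rewrite /pairing (rsum_set1 oe).
    by rewrite coef_de eqxx eq_sym obar_neqb subr0 mul1r.
  move=> f of_ /negbTE fe; rewrite coef_de fe; case: eqVneq => [fE|_].
    by move: of_; rewrite fE => /ori_obar.
  by rewrite subrr !mul0r.
have oe : ori G (obar e) by apply/ori_obar.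
rewrite /pairing (rsum_set1 oe).
  by rewrite coef_de eqxx obar_neqb sub0r coef_obar// mulrNN mul1r len_obar.
move=> f of_ /negbTE fe; rewrite coef_de fe; case: eqVneq => [fE|_].
  by move: of_; rewrite fE.
by rewrite subrr !mul0r.
Qed.

Lemma dstar_de e v : dstar (de e) v = (v == tgt e)%:R - (v == src e)%:R.
Proof.
rewrite dstarE; last exact: C1_de.
have fin : finite_set [set f : oedge G | src f = v] by exact: finite_src.
have one f : \sum_(g \in [set g : oedge G | src g = v]) ((g == f)%:R : R) = (v == src f)%:R.
  case: eqVneq => [vE|/eqP vN].
    rewrite (fsbigD1 f)//=.
    rewrite eqxx fsbig1 ?addr0// => g [_ /eqP/negbTE ->//].
  rewrite fsbig1// => g /= gv; case: eqVneq => // gf.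
  by case: vN; rewrite -gv gf.
under eq_fsbigr do rewrite coef_de -mulN1r.
rewrite fsbig_split//= -mulr_fsumr !one src_obar mulN1r opprD opprK addrC //.
Qed.

Lemma harmonic_L2 h : Defs.harmonic h -> C1_L2 h. Proof. by case. Qed.

(** [p] is the Riesz representer of evaluation at [e], up to the factor [len e]. Taking [h = p]
    shows that [coef p e * len e] is the squared norm of [p], which yields the sign and vanishing
    statements below. *)
Lemma projection_pairing e p h : harmonic_projection (de e) p -> Defs.harmonic h ->
  pairing p h = coef h e * len e.
Proof.
move=> [hp orth] hh; have := orth _ hh.
rewrite (_ : (fun e' => de e e' - p e') = (fun e' => 1 * de e e' + (-1) * p e')); last first.
  by apply/funext => e'; rewrite mul1r mulN1r.
rewrite pairing_lin; [|exact: L2_de|exact: harmonic_L2..].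
have [[ch _] _] := hh.
by rewrite pairing_de// mul1r mulN1r => /subr0_eq.
Qed.

Lemma projection_ge0 e p : harmonic_projection (de e) p -> 0 <= coef p e.
Proof.
move=> pP; have [hp _] := pP.
have := pairing_ge0 (harmonic_L2 hp); rewrite (projection_pairing pP hp).
by rewrite pmulr_lge0.
Qed.

Lemma projection_eq0 e p f : harmonic_projection (de e) p -> coef p e = 0 -> coef p f = 0.
Proof.
move=> pP p0; have [hp _] := pP.
apply: pairing_eq0 (harmonic_L2 hp) _ f.
by rewrite (projection_pairing pP hp) p0 mul0r.
Qed.

(* Both sides have the same [dstar], and their difference is orthogonal to all
   harmonic forms. *)
Lemma projection_dirac e p w0 w1 f : harmonic_projection (de e) p ->
  min_dirac_form (src e) w0 -> min_dirac_form (tgt e) w1 ->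
  coef w1 f - coef w0 f = coef (de e) f - coef p f.
Proof.
move=> pP m0 m1; have [hp _] := pP.
have [[l0 d0] _] := m0; have [[l1 d1] _] := m1.
have lp := harmonic_L2 hp; have ld := L2_de e.
pose u := fun f => 1 * w1 f + (-1) * w0 f.
pose z := fun f => 1 * de e f + (-1) * p f.
pose k := fun f => 1 * u f + (-1) * z f.
have lu : C1_L2 u by exact: C1_L2_lin.
have lz : C1_L2 z by exact: C1_L2_lin.
have lk : C1_L2 k by exact: C1_L2_lin.
have [[c0 _] [c1 _] [cp _]] := And3 l0 l1 lp.
have hk : Defs.harmonic k.
  split=> // v vv; rewrite dstar_lin; [|by case: lu|by case: lz].
  rewrite !dstar_lin//; last exact: C1_de.
  have [_ dp] := hp.
  by rewrite d0// d1// dp// dstar_de; lra.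
(* The harmonic [k] is orthogonal to [w0] and [w1] by minimality, and pairs equally with [de e] and
   with its projection. *)
have k0 : pairing k k = 0.
  rewrite {1}/k pairing_lin// /u /z !pairing_lin//.
  rewrite (min_dirac_form_orth m0 hk) (min_dirac_form_orth m1 hk).
  rewrite (projection_pairing pP hk) pairing_de; last by case: lk.
  by lra.
have := pairing_eq0 lk k0 f.
by rewrite /k /u /z !coef_lin; lra.
Qed.

Definition restrict (X : set (oedge G)) w : oedge G -> R :=
  fun f => if `[< X f >] then w f else 0.

Lemma coef_restrict X w f : coef (restrict X w) f = if `[< X f >] then coef w f else 0.
Proof. by rewrite /coef /restrict; case: ifP => //; rewrite mul0r. Qed.

Lemma restrict_L2 X w : (forall f, X (obar f) <-> X f) -> C1_L2 w -> C1_L2 (restrict X w).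
Proof.
move=> Xo [cw lw]; split.
  move=> f; rewrite /restrict; have -> : `[< X (obar f) >] = `[< X f >] by apply: asbool_equiv_eq.
  by case: ifP; rewrite ?cw ?oppr0.
apply: le_lt_trans lw; apply: le_esum => f _; rewrite lee_fin coef_restrict.
by case: ifP => // _; rewrite expr0n mul0r mulr_ge0 ?sqr_ge0// ltW.
Qed.

End forms.

Section edge_forms.
Context {R : realType} {T : metricType R}.
Hypotheses (mT : metric_graph T) (sT : simply_connected T).
Context (G : model T) (e : oedge G).
Implicit Types (f : oedge G) (w h p : oedge G -> R) (v x : T) (a b : R).

(** Edges of the half tree beyond [e], in both orientations. The edge [e] is included so that a
    restricted form keeps its flow through [e]. Any other edge lies wholly on one side, so its
    midpoint decides. *)
Definition beyond : set (oedge G) :=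
  [set f | [\/ f = e, f = obar e | branch e (par f (len f / 2))]].

Lemma beyond_obar f : beyond (obar f) <-> beyond f.
Proof.
have half g : par (obar g) (len (obar g) / 2) = par g (len g / 2) :> T.
  have := len_gt0 g => g0; rewrite len_obar par_obar; last by lra.
  by congr par; lra.
rewrite /beyond /= half; split=> -[fE|fE|]; try (by constructor 3).
- by constructor 2; rewrite -fE obarK.
- by constructor 1; rewrite -[f]obarK fE obarK.
- by constructor 2; rewrite fE.
- by constructor 1; rewrite fE obarK.
Qed.

Lemma beyond_src f : branch e (src f) -> beyond f.
Proof.
move=> ef; have [fe|[fe|fe]] := edge_in_branch mT e f.
- have : f = e \/ f = obar e by apply: par_edge_inj; rewrite -[LHS]/(edge e) -fe.
  by case=> ->; [constructor 1|constructor 2].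
- by constructor 3; apply: fe; apply: edge_cedge; exact: edge_mid.
- by case: (branch_disj mT sT ef); apply: fe; exact: cedge_src.
Qed.

Lemma beyond_not_src f : ~ branch e (src f) -> beyond f -> f = e.
Proof.
move=> nef [//|fE|ef].
  by case: nef; rewrite fE src_obar; exact: branch_tgt.
case: nef; apply: (cedge_sub_branch _ (edge_mid f) (edge_cedge (edge_mid f)) ef).
  exact: branch_avoid ef.
exact: cedge_src.
Qed.

(** At a vertex beyond [e] all incident edges are kept. At any other vertex the only outgoing edge
    that can survive is [e] itself, so the cut creates a defect at [src e] alone, equal to minus the
    flow through [e]. *)
Lemma dstar_beyond w v : C1_L2 w -> dstar (restrict beyond w) v =
  if `[< branch e v >] then dstar w v else - ((v == src e)%:R * coef w e).
Proof.
move=> lw; have [cw _] := lw; have [cr _] := restrict_L2 beyond_obar lw.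
rewrite !dstarE//; case: asboolP => [ev|nev]; congr (- _).
  apply: eq_fsbigr => f; rewrite inE /= => fv; rewrite coef_restrict.
  by case: asboolP => // -[]; apply: beyond_src; rewrite fv.
have fin := finite_src mT G v.
have zero f : src f = v -> f != e -> coef (restrict beyond w) f = 0.
  move=> fv /eqP fe; rewrite coef_restrict; case: asboolP => // bf.
  by case: fe; apply: beyond_not_src bf; rewrite fv.
case: eqVneq => [vE|/eqP vN].
  rewrite (fsbigD1 e)//=.
  rewrite coef_restrict mul1r; case: asboolP => [_|[]]; last by constructor 1.
  by rewrite fsbig1 ?addr0// => f [/= fv /eqP]; exact: zero.
rewrite mul0r fsbig1// => f /= fv; apply: zero => //.
by apply/eqP => fe; apply: vN; rewrite -fv fe.
Qed.

Lemma src_notin v : branch e v -> (v == src e) = false.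
Proof.
by move=> ev; apply/eqP => vE; apply: (src_notin_branch mT sT (e := e)); rewrite -vE.
Qed.

(* Beyond [e], both [p] and [w0] minimise the energy among forms with the same
   flow through [e], so they are proportional there. *)
Lemma projection_proportional p w0 : harmonic_projection (de e) p ->
  min_dirac_form (src e) w0 -> coef w0 e <= 0 ->
  exists2 k, 0 <= k & forall f, beyond f -> coef p f = - (k * coef w0 f).
Proof.
move=> pP m0 a0; have [hp _] := pP; have [[l0 d0] _] := m0; have lp := harmonic_L2 hp.
set a := coef w0 e in a0; pose b := coef p e.
have b0 : 0 <= b by exact: projection_ge0 pP.
have [_ dp] := hp; have [[c0 _] [cp _]] := conj l0 lp.
(* The combination without flow through [e]: cutting it off at [e] creates no defect, so its
   restriction [h] is harmonic. *)
pose u := fun f => a * p f + (- b) * w0 f.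
have lu : C1_L2 u by exact: C1_L2_lin.
pose h := restrict beyond u.
have lh : C1_L2 h by exact: restrict_L2 beyond_obar lu.
have ue : coef u e = 0 by rewrite coef_lin -/a -/b; lra.
have hh : Defs.harmonic h.
  split=> // v vv; rewrite dstar_beyond//; case: asboolP => [ev|_].
    by rewrite dstar_lin// dp// d0// src_notin// !mulr0 addr0.
  by rewrite ue mulr0 oppr0.
have he : coef h e = 0.
  by rewrite coef_restrict ue; case: ifP.
have prop f : beyond f -> a * coef p f = b * coef w0 f.
  move=> bf; have h0 : pairing h h = 0.
    transitivity (pairing u h).
      apply: eq_rsum => g _; rewrite coef_restrict; case: ifP => //.
      by rewrite !(mul0r, mulr0).
    rewrite /u pairing_lin// (projection_pairing pP hh) he.
    by rewrite (min_dirac_form_orth mT m0 hh) mul0r !mulr0 addr0.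
  have := pairing_eq0 lh h0 f; rewrite coef_restrict; case: asboolP => // _.
  by rewrite coef_lin; lra.
have [b1|/eqP bN] := eqVneq b 0.
  exists 0 => // f _; rewrite mul0r oppr0; exact: projection_eq0 pP b1.
(* If [a] were zero, [w0] would vanish beyond [e]. Adding [b * w0] to the restriction of [p] cancels
   the defect at [src e], and pairing the resulting harmonic form with [w0] leaves [b] times the
   squared norm of [w0]. This must be zero, although [w0] has source 1 at [src e]. *)
have a1 : a != 0.
  apply/eqP => aE.
  have w00 f : beyond f -> coef w0 f = 0.
    move=> bf; have /esym/eqP := prop f bf; rewrite aE mul0r mulf_eq0.
    by move/eqP/negbTE: bN => -> /eqP.
  pose h2 := fun f => 1 * restrict beyond p f + b * w0 f.
  have lr : C1_L2 (restrict beyond p) by exact: restrict_L2 beyond_obar lp.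
  have [cr _] := lr.
  have hh2 : Defs.harmonic h2.
    split; first exact: C1_L2_lin.
    move=> v vv; rewrite dstar_lin// dstar_beyond//; case: asboolP => [ev|_].
      by rewrite dp// d0// src_notin// !mulr0 addr0.
    by rewrite d0// -/b; case: eqP => _; lra.
  have := min_dirac_form_orth mT m0 hh2; rewrite pairingC pairing_lin//.
  rewrite [pairing (restrict _ _) _]rsum_eq0; last first.
    move=> f _; rewrite coef_restrict; case: asboolP => [/w00 ->|_]; by rewrite ?mulr0 ?mul0r.
  rewrite mulr0 add0r => /eqP; rewrite mulf_eq0; move/eqP/negbTE: bN => -> /eqP w0E.
  have := d0 (src e) (src_vtx e); rewrite dstarE// fsbig1; last first.
    by move=> f _; exact: pairing_eq0 l0 w0E f.
  by rewrite eqxx oppr0 => /eqP; rewrite eq_sym oner_eq0.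
exists (- (b / a)).
  by rewrite -mulrN mulr_ge0// oppr_ge0 invr_le0.
by move=> f /prop E; rewrite mulNr opprK mulrAC -E mulrC mulKf.
Qed.

End edge_forms.

(** * The measures on the space of ends *)

Section total_variation.
Context d (X : measurableType d) (R : realType).
Implicit Types nu : {charge set X -> \bar R}.

(** Hahn decompositions agree up to null sets, so the one chosen inside [charge_tv] can be traded
    for an explicit one. *)
Lemma charge_tvE nu P N : hahn_decomposition nu P N -> charge_tv nu = (nu P - nu N)%E.
Proof.
move=> PN; rewrite /charge_tv; move: (projT2 _) => exN; move: (cid exN) => [N' H] /=.
have [P1 N1] := Hahn_decomposition_uniq H PN measurableT.
rewrite !setTI in P1 N1.
rewrite /charge_variation /= jordan_posE jordan_negE cjordan_posE cjordan_negE.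
by rewrite /crestr0 mem_set//= /crestr !setTI P1 N1.
Qed.

Lemma charge_tv_eq0 nu : (forall A, measurable A -> nu A = 0%E) -> charge_tv nu = 0%E.
Proof.
move=> nu0; rewrite (@charge_tvE nu setT set0); first by rewrite !nu0// sube0.
by split; [split=> // A mA _; rewrite nu0|split=> // A mA _; rewrite nu0|
  rewrite setU0|rewrite setI0].
Qed.

Lemma hahn_decomposition_scale nu P N (c : R) : 0 <= c ->
  hahn_decomposition nu P N -> hahn_decomposition (cscale c nu) P N.
Proof.
move=> c0 [[mP pP] [mN nN] PN1 PN2]; split => //; split => // A mA AP; rewrite /= /cscale.
  by rewrite mule_ge0// ?lee_fin// pP.
by rewrite mule_ge0_le0// ?lee_fin// nN.
Qed.

Lemma charge_tvZ nu (c : R) : 0 <= c -> charge_tv (cscale c nu) = (c%:E * charge_tv nu)%E.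
Proof.
move=> c0; have [P [N PN]] := Hahn_decomposition nu.
rewrite (charge_tvE (hahn_decomposition_scale c0 PN)) (charge_tvE PN) /= /cscale.
have [[mP _] [mN _] _ _] := PN.
by rewrite muleBr// fin_num_adde_defr// fin_num_measure.
Qed.

Lemma prob_diffE (m n : probability X R) A : prob_diff m n A = (m A - n A)%E.
Proof. by []. Qed.

End total_variation.

Section harmonic_measures.
Context {R : realType} {T : metricType R}.
Hypotheses (mT : metric_graph T) (sT : simply_connected T).
Context (o : ends T) (mu : T -> probability (borel o) R).
Hypothesis mu_end : forall x, end_measure x (mu x).
Context (G : model T).
Implicit Types (e f : oedge G) (p w : oedge G -> R).

Definition mass x e : R := fine (mu x (branch_ends e)).

Lemma massE x e : mu x (branch_ends e) = (mass x e)%:E.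
Proof. by rewrite /mass fineK// fin_num_measure//; exact: measurable_branch_ends. Qed.

Lemma mass_obar x e : mass x (obar e) = 1 - mass x e.
Proof.
rewrite /mass branch_ends_obar// probability_setC; last exact: measurable_branch_ends.
by rewrite massE.
Qed.

Lemma end_form x : vtx G x -> exists2 w : oedge G -> R, min_dirac_form x w &
  forall e, ~ branch e x -> mass x e = - coef w e.
Proof.
move=> vx; have [w mw wE] := mu_end vx.
by exists w => // e nex; rewrite /mass wE.
Qed.

Lemma harmonic_C1 (h : oedge G -> R) : Defs.harmonic h -> C1 h.
Proof. by move=> [[]]. Qed.

(** The Dirac forms give masses only for edges pointing away from the base vertex. An edge [f]
    pointing towards [e] is therefore reversed, which changes the sign of both sides because the
    total masses cancel. *)
Lemma projection_mass e p f : harmonic_projection (de e) p ->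
  mass (tgt e) f - mass (src e) f = coef p f.
Proof.
move=> pP; have [hp _] := pP; have cp := harmonic_C1 hp.
have [w0 m0 w0E] := end_form (src_vtx e).
have [w1 m1 w1E] := end_form (tgt_vtx e).
have c1 : C1 w1 by have [[[]]] := m1.
have pd g := projection_dirac mT g pP m0 m1.
(* [e] points away from [src e] but towards [tgt e]. The 1 coming from reversing it for [tgt e]
   cancels the value 1 of [coef (de e) e]. *)
have onE : mass (tgt e) e - mass (src e) e = coef p e.
  rewrite (w0E e (src_notin_branch mT sT (e := e))).
  have : ~ branch (obar e) (tgt e) by exact: branch_disj (branch_tgt e).
  move=> /w1E; rewrite mass_obar coef_obar//.
  by have := pd e; rewrite coef_de eqxx eq_sym obar_neqb /= => H1 H2; lra.
have away g : g != e -> g != obar e -> ~ branch g (src e) -> ~ branch g (tgt e) ->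
    mass (tgt e) g - mass (src e) g = coef p g.
  move=> /negbTE ge /negbTE ge' /w0E -> /w1E ->.
  by have := pd g; rewrite coef_de ge ge'; lra.
have [->//|fe] := eqVneq f e.
have [->|fe'] := eqVneq f (obar e).
  by rewrite !mass_obar coef_obar// -onE; lra.
have [eE|[ef|ef]] := edge_in_branch mT f e.
- have : f = e \/ f = obar e by apply: par_edge_inj; rewrite -[LHS]/(edge e) eE.
  by case=> fE; [move: fe|move: fe']; rewrite fE eqxx.
- have := away (obar f); rewrite !mass_obar coef_obar//.
  rewrite (can2_eq (@obarK _ _ G) (@obarK _ _ G)) fe'.
  rewrite (inj_eq (can_inj (@obarK _ _ G))) fe.
  have na : ~ branch (obar f) (src e).
    by move=> H; apply: (branch_disj mT sT (ef _ (cedge_src e)) H).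
  have nb : ~ branch (obar f) (tgt e).
    by move=> H; apply: (branch_disj mT sT (ef _ (cedge_tgt e)) H).
  by move=> /(_ isT isT na nb) H; lra.
- apply: away => // H.
    exact: (branch_disj mT sT H (ef _ (cedge_src e))).
  exact: (branch_disj mT sT H (ef _ (cedge_tgt e))).
Qed.

Lemma sub_branch_beyond e f : branch f `<=` branch e -> beyond e f.
Proof.
move=> fe; have [fE|[fE|fE]] := edge_in_branch mT e f.
- have : f = e \/ f = obar e by apply: par_edge_inj; rewrite -[LHS]/(edge e) -fE.
  by case=> ->; [constructor 1|constructor 2].
- by constructor 3; apply: fE; apply: edge_cedge; exact: edge_mid.
- by case: (branch_disj mT sT (fe _ (branch_tgt f))); apply: fE; exact: cedge_tgt.
Qed.

(* On the ends beyond [e], the measure seen from [tgt e] is a multiple [1 + k]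
   of the one seen from [src e]. *)
Lemma end_measure_le e p (A : set (borel o)) : harmonic_projection (de e) p -> measurable A ->
  A `<=` branch_ends e -> (mu (src e) A <= mu (tgt e) A)%E.
Proof.
move=> pP mA AE.
have [w0 m0 w0E] := end_form (src_vtx e).
have nbe := src_notin_branch mT sT (e := e).
have a0 : coef w0 e <= 0.
  by rewrite -oppr_ge0 -w0E//; apply: fine_ge0; exact: measure_ge0.
have [k k0 kE] := projection_proportional mT sT pP m0 a0.
have mE := measurable_branch_ends o e.
have k1 : 0 <= 1 + k by lra.
pose m1 := mrestr (mu (tgt e)) mE.
pose m2 := mscale (NngNum k1) (mrestr (mu (src e)) mE).
have beyondE f : beyond e f -> ~ branch f (src e) ->
    mu (tgt e) (branch_ends f) = ((1 + k)%:E * mu (src e) (branch_ends f))%E.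
  move=> bf nf; rewrite !massE -EFinM; congr EFin.
  have := projection_mass f pP; rewrite (kE _ bf) -[in RHS]mulrN -w0E//.
  by lra.
have eE : mu (tgt e) (branch_ends e) = ((1 + k)%:E * mu (src e) (branch_ends e))%E.
  by apply: beyondE => //; constructor 1.
(* Restricted to the ends beyond [e], the two measures need only be compared on branches away from
   [src e]. Each of these contains, is contained in, or is disjoint from the branch of [e], which
   reduces everything to [beyondE]. *)
have key : m1 A = m2 A.
  apply: (eq_measure_branch_ends mT sT (G := G) (x0 := src e)) => //.
  - exact: src_vtx.
  - by rewrite /= /mrestr setTI ltey_eq fin_num_measure.
  - by rewrite /= /mscale /= /mrestr !setTI.
  move=> f nf; rewrite /= /mscale /= /mrestr.
  have [ef|fe|ef] := branch_nested mT sT (src_vtx e) nbe nf.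
  - by rewrite (setIidr (branch_endsS ef)).
  - by rewrite (setIidl (branch_endsS fe)); apply: beyondE => //; exact: sub_branch_beyond.
  - by rewrite setIC branch_ends_disj// !measure0 mule0.
move: key; rewrite /m1 /m2 /mscale /= /mrestr (setIidl AE) => ->.
rewrite -[leLHS]mul1e; apply: lee_wpmul2r => //.
by rewrite lee_fin; lra.
Qed.

Hypothesis projections : forall e, exists p, harmonic_projection (de e) p.

(** Positivity beyond [e] is [end_measure_le]; negativity on the complement is the same inequality
    for [obar e], which exchanges the two endpoints. *)
Lemma prob_diff_hahn e :
  hahn_decomposition (prob_diff (mu (tgt e)) (mu (src e)))
    (branch_ends e) (branch_ends (obar e)).
Proof.
have [p pP] := projections e; have [q qP] := projections (obar e).
split.
- split; first exact: measurable_branch_ends.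
  move=> A mA Ae; rewrite prob_diffE sube_ge0 ?fin_num_measure//.
  exact: end_measure_le pP mA Ae.
- split; first exact: measurable_branch_ends.
  move=> A mA Ae; rewrite prob_diffE sube_le0.
  by have := end_measure_le qP mA Ae; rewrite src_obar tgt_obar.
- by rewrite branch_ends_obar// setUv.
- by rewrite branch_ends_obar// setICr.
Qed.

Lemma prob_diff_tv e p : harmonic_projection (de e) p ->
  charge_tv (prob_diff (mu (tgt e)) (mu (src e))) = (2 * coef p e)%:E.
Proof.
move=> pP; rewrite (charge_tvE (prob_diff_hahn e)) !prob_diffE !massE -!EFinB.
congr EFin; rewrite !mass_obar -(projection_mass e pP); lra.
Qed.

End harmonic_measures.

(** * Cutting an edge at an interior point *)

Section subdivision.
Context {R : realType} {T : metricType R} (G : model T) (e : oedge G) (t : R).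
Hypothesis tl : 0 < t < len e.
Implicit Types (f : oedge G) (s : oedge G + bool).

Let x := par e t.

Let ex : edge e x. Proof. exact: par_in_edge. Qed.

Let nvx : ~ vtx G x. Proof. exact: edge_notin_vtx ex. Qed.

(* [e] is cut at [par e t]: [inl e] is the initial piece, [inr true] the final
   one.  Each new edge is a piece of an old one, starting at distance
   [sub_off] from its source. *)
Definition sub_obar s : oedge G + bool :=
  match s with inl f => inl (obar f) | inr b => inr (~~ b) end.

Definition sub_ori : set (oedge G + bool) :=
  [set s : oedge G + bool | match s with inl f => ori G f | inr b => is_true b end].

Definition sub_base s : oedge G :=
  match s with inl f => f | inr b => if b then e else obar e end.

Definition sub_off s : R :=
  match s with
  (* [inl (obar e)] is the initial piece run backwards, so along [obar e] it starts at the cut. *)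
  | inl f => if f == obar e then len e - t else 0
  | inr b => if b then t else 0
  end.

Definition sub_len s : R :=
  match s with
  | inl f => if (f == e) || (f == obar e) then t else len f
  | inr _ => len e - t
  end.

Definition sub_par s (u : R) : T := par (sub_base s) (sub_off s + u).

Definition sub_vtx : set T := vtx G `|` [set x].

Let obar_eqC f g : (obar f == g) = (f == obar g).
Proof. exact: (can2_eq (@obarK _ _ G) (@obarK _ _ G)). Qed.

Let obar_neqe f : (obar f == f) = false.
Proof. by apply/eqP; exact: obar_neq. Qed.

Let sub_off_ge0 s : 0 <= sub_off s.
Proof. by have := tl; case: s => [f|[]] /=; try case: ifP => _; lra. Qed.

Let sub_len_gt0 s : 0 < sub_len s.
Proof. by have := tl; case: s => [f|[]] /=; try case: ifP => _; rewrite ?len_gt0//; lra. Qed.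

(** A piece and its distances to the two ends fill the old edge; compatibility with reversal and all
    range conditions on parameters come from this. *)
Let sub_off_len s : sub_off (sub_obar s) + sub_off s + sub_len s = len (sub_base s).
Proof.
case: s => [f|[]] /=; [|lra|by rewrite len_obar; lra].
rewrite obar_eqC obarK; case: eqVneq => [->|fe] /=.
  by rewrite eq_sym obar_neqe; lra.
case: eqVneq => [->|fe'] /=; last by rewrite !add0r.
by rewrite len_obar; lra.
Qed.

Let sub_off_le s : sub_off s + sub_len s <= len (sub_base s).
Proof. by rewrite -sub_off_len; have := sub_off_ge0 (sub_obar s); lra. Qed.

Let sub_base_obar s : sub_base (sub_obar s) = obar (sub_base s).
Proof. by case: s => [f|[]] //=; rewrite obarK. Qed.

Let sub_obarK : involutive sub_obar.
Proof. by case=> [f|[]] //=; rewrite obarK. Qed.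

Let sub_len_obar s : sub_len (sub_obar s) = sub_len s.
Proof.
case: s => [f|[]] //=.
by rewrite obar_eqC (inj_eq (can_inj (@obarK _ _ G))) len_obar orbC.
Qed.

Let sub_par_obar s u : 0 <= u <= sub_len s ->
  sub_par (sub_obar s) u = sub_par s (sub_len s - u).
Proof.
move=> us; rewrite /sub_par sub_base_obar.
have := sub_off_ge0 s; have := sub_off_len s; have := sub_off_ge0 (sub_obar s) => o0 oE o1.
by rewrite par_obar; [congr par|]; lra.
Qed.

Let sub_itv s u : 0 < u < sub_len s -> 0 < sub_off s + u < len (sub_base s).
Proof. by have := sub_off_ge0 s; have := sub_off_le s; lra. Qed.

Let sub_vtx_discrete (y : T) : exists2 U, nbhs y U & U `&` sub_vtx `<=` [set y].
Proof.
have [U yU Uv] := vtx_discrete G y; have [xy|/eqP yx] := eqVneq x y.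
  by exists U => // z [Uz [vz|->//]]; exact: Uv.
exists (U `&` ~` [set x]).
  apply: filterI => //; apply: open_nbhs_nbhs; split; last by move=> /esym.
  apply: closed_openC; apply: accessible_closed_set1.
  by apply: hausdorff_accessible; exact: metric_hausdorff.
by move=> z [[Uz zx] [vz|/zx//]]; exact: Uv.
Qed.

Let sub_par_local_isometry s u : 0 < u < sub_len s ->
  exists2 d : R, 0 < d & forall v v', `|v - u| < d -> `|v' - u| < d ->
    mdist (sub_par s v) (sub_par s v') = `|v - v'|.
Proof.
move=> /sub_itv /par_local_isometry[d d0 dI]; exists d => // v v' vu v'u.
have sh a b : sub_off s + a - (sub_off s + b) = a - b by lra.
by rewrite /sub_par dI ?sh.
Qed.

Let sub_par_inj s u v : 0 < u < sub_len s -> 0 < v < sub_len s ->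
  sub_par s u = sub_par s v -> u = v.
Proof. by move=> us vs /par_inj H; apply: (addrI (sub_off s)); apply: H; exact: sub_itv. Qed.

Let sub_par_continuous s : {within `[0, sub_len s], continuous (sub_par s)}.
Proof.
apply/subspace_continuousP => u /=; rewrite in_itv /= => us.
have := (subspace_continuousP _ _).1 (@par_continuous _ _ _ (sub_base s)) (sub_off s + u).
have itv v : 0 <= v <= sub_len s -> 0 <= sub_off s + v <= len (sub_base s).
  by have := sub_off_ge0 s; have := sub_off_le s; lra.
rewrite /= in_itv /= itv// => /(_ isT) pc W /pc /= /nbhs_ballP[d /= d0 dW].
apply/nbhs_ballP; exists d => //= v; rewrite /ball /= in_itv /= => uv vs.
apply: dW; rewrite ?in_itv /= ?itv// /ball /=.
by have -> : sub_off s + u - (sub_off s + v) = u - v by lra.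
Qed.

Let sub_par0_vtx s : sub_vtx (sub_par s 0).
Proof.
have tl' := tl; rewrite /sub_par addr0; case: s => [f|[]] /=; [|by right|by left; exact: src_vtx].
case: eqVneq => [->|_]; last by left; exact: src_vtx.
by right; rewrite /= par_obar; [congr par|]; lra.
Qed.

Let sub_edge s : set T := sub_par s @` `]0, sub_len s[.

Let sub_edgeE s : sub_edge s = par (sub_base s) @` `]sub_off s, (sub_off s + sub_len s)[.
Proof.
apply/seteqP; split=> _ [u /= + <-]; rewrite in_itv /= => us.
  by exists (sub_off s + u) => //=; rewrite in_itv /=; lra.
exists (u - sub_off s); first by rewrite /= in_itv /=; lra.
by rewrite /sub_par addrC subrK.
Qed.

Let sub_edge_edge s : sub_edge s `<=` edge (sub_base s).
Proof. by move=> _ [u /= + <-]; rewrite in_itv /= => /sub_itv; exact: par_in_edge. Qed.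

Let sub_edge_obar s : sub_edge (sub_obar s) = sub_edge s.
Proof.
have sub s' : sub_edge (sub_obar s') `<=` sub_edge s'.
  move=> _ [u /= + <-]; rewrite in_itv /= sub_len_obar => us.
  rewrite sub_par_obar; last lra.
  by exists (sub_len s' - u) => //=; rewrite in_itv /=; lra.
by apply/seteqP; split; [exact: sub|rewrite -{1}[s]sub_obarK; exact: sub].
Qed.

Let x_notin_inl f : ~ sub_edge (inl f) x.
Proof.
have ne : ~ sub_edge (inl e) x.
  move=> [u /= + ux]; rewrite in_itv /= eqxx /= => us.
  have tl' := tl; move: ux; rewrite /sub_par /= eq_sym obar_neqe add0r => /par_inj H.
  have /H/(_ tl) : 0 < u < len e by lra.
  by lra.
have [->//|fe] := eqVneq f e.
have [->|fe'] := eqVneq f (obar e).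
  by rewrite -[inl _]/(sub_obar (inl e)) sub_edge_obar.
move=> /sub_edge_edge /= fx.
by case: (edge_inj ex fx) => fE; [move: fe|move: fe']; rewrite fE eqxx.
Qed.

Let x_notin_inr b : ~ sub_edge (inr b) x.
Proof.
have ne : ~ sub_edge (inr true) x.
  move=> [u /= + ux]; rewrite in_itv /= => us.
  have tl' := tl; move: ux; rewrite /sub_par /= => /par_inj H.
  have /H/(_ tl) : 0 < t + u < len e by lra.
  by lra.
case: b => //.
by rewrite -[inr false]/(sub_obar (inr true)) sub_edge_obar.
Qed.

Let sub_edge_notin_vtx s : sub_edge s `<=` ~` sub_vtx.
Proof.
move=> y sy [vy|yx]; first by case: (edge_notin_vtx (sub_edge_edge sy)).
by move: sy; rewrite yx; case: s => [f|b]; [exact: x_notin_inl|exact: x_notin_inr].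
Qed.

(** The open piece is open, the closed piece is closed, and they differ only by new vertices.
    Membership in the piece is thus locally constant off the vertices, and the piece fills its
    component. *)
Let sub_par_component s : exists2 y, ~ sub_vtx y &
  sub_edge s = connected_component (~` sub_vtx) y.
Proof.
pose y := sub_par s (sub_len s / 2).
have sy : sub_edge s y.
  by exists (sub_len s / 2) => //=; rewrite in_itv /=; have := sub_len_gt0 s; lra.
have nvy := sub_edge_notin_vtx sy; exists y => //.
apply/seteqP; split.
  apply: connected_component_max => //.
  apply: connected_continuous_connected.
    exact/connected_intervalP/interval_is_interval.
  by apply: continuous_subspaceW (@sub_par_continuous s) => u /=; rewrite !in_itv /=; lra.
apply: (connected_locally_constant (x := y)) => //.
- exact: component_connected.
- exact: connected_component_refl.
move=> z /connected_component_sub nz.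
have off0 := sub_off_ge0 s; have offl := sub_off_le s.
have [sz|nsz] := pselect (sub_edge s z).
  have : nbhs z (sub_edge s).
    by apply: open_nbhs_nbhs; split => //; rewrite sub_edgeE; exact: par_open.
  by apply: filterS => v sv _; split.
have : nbhs z (~` (par (sub_base s) @` `[sub_off s, sub_off s + sub_len s])).
  apply: open_nbhs_nbhs; split; first by apply: closed_openC; exact: par_closed.
  move=> [u /= + uz]; rewrite in_itv /= => /andP[].
  rewrite le_eqVlt => /predU1P[ou _|ou].
    by apply: nz; rewrite -uz -ou -[sub_off s]addr0; exact: sub_par0_vtx.
  rewrite le_eqVlt => /predU1P[uo|uo].
    apply: nz; rewrite -uz uo.
    have := sub_par0_vtx (sub_obar s); rewrite sub_par_obar ?subr0//.
    by rewrite lexx ltW.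
  by apply: nsz; rewrite sub_edgeE; exists u => //=; rewrite in_itv /= ou.
apply: filterS => v nv _; split => // sv; case: nv.
move: sv; rewrite sub_edgeE => -[u /= + <-]; rewrite in_itv /= => us.
by exists u => //=; rewrite in_itv /=; lra.
Qed.

Let sub_par_surj y : ~ sub_vtx y -> exists s, sub_edge s y.
Proof.
move=> /not_orP[/par_surj[f fy] yx].
have tl' := tl; have [ey|ney] := pselect (edge e y).
  move: ey yx => [u /= + <-]; rewrite in_itv /= => ul ux.
  have [ut|ut|ut] := ltgtP u t; last by case: ux; rewrite ut.
  - exists (inl e); rewrite sub_edgeE /= eq_sym obar_neqe eqxx /= add0r.
    by exists u => //=; rewrite in_itv /=; lra.
  - exists (inr true); rewrite sub_edgeE /=; exists u => //=.
    by rewrite in_itv /=; lra.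
exists (inl f); rewrite sub_edgeE /=.
have /negbTE -> : f != e by apply/eqP => fe; apply: ney; rewrite -fe.
have /negbTE -> : f != obar e by apply/eqP => fe; apply: ney; rewrite -edge_obar -fe.
by rewrite /= add0r.
Qed.

Let sub_par_edge_inj s s' : sub_edge s = sub_edge s' -> s' = s \/ s' = sub_obar s.
Proof.
have mid r : exists2 y, sub_edge r y & True.
  exists (sub_par r (sub_len r / 2)) => //.
  by exists (sub_len r / 2) => //=; rewrite in_itv /=; have := sub_len_gt0 r; lra.
have clash f b : sub_edge (inl f) = sub_edge (inr b) -> False.
  move=> fb.
  have {}fb : sub_edge (inl f) = sub_edge (inr true).
    rewrite fb; case: b {fb} => //.
    by rewrite -[inr false]/(sub_obar (inr true)) sub_edge_obar.
  have [y fy _] := mid (inl f).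
  have : f = e \/ f = obar e.
    have ey : edge e y by move: fy; rewrite fb => /sub_edge_edge.
    exact: edge_inj ey (sub_edge_edge fy).
  have {}fb : f = e \/ f = obar e -> sub_edge (inl e) = sub_edge (inr true).
    by move=> [fE|fE]; rewrite -fb fE// -[inl (obar e)]/(sub_obar (inl e)) sub_edge_obar.
  move=> /fb {}fb.
  have [z ez _] := mid (inl e); move: (ez); rewrite fb.
  move: ez => [u /= + <-] [v /= + uv]; rewrite !in_itv /= eqxx /= => us vs.
  have tl' := tl; move: uv; rewrite /sub_par /= eq_sym obar_neqe add0r => /par_inj H.
  have /H H' : 0 < t + v < len e by lra.
  have /H' : 0 < u < len e by lra.
  by lra.
case: s s' => [f|b] [f'|b'].
- move=> ff; have [y fy _] := mid (inl f).
  have f'y : sub_edge (inl f') y by rewrite -ff.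
  by case: (edge_inj (sub_edge_edge fy) (sub_edge_edge f'y)) => /= ->; [left|right].
- by move=> /clash.
- by move=> /esym/clash.
- by move=> _; case: b; case: b'; [left|right|right|left].
Qed.

Let sub_vtx_valence (y : T) : ~ valence y 2 -> sub_vtx y.
Proof. by move=> /(@vtx_valence _ _ G); left. Qed.

Let sub_obar_neq s : sub_obar s <> s.
Proof. by case: s => [f|[]] //= [] /obar_neq. Qed.

Let sub_ori_obar s : sub_ori (sub_obar s) <-> ~ sub_ori s.
Proof. by case: s => [f|b] /=; [exact: ori_obar|by split=> /negP]. Qed.

Definition subdivide : model T :=
  @Model R T sub_vtx (oedge G + bool)%type sub_obar sub_ori sub_len sub_par
    sub_vtx_discrete sub_vtx_valence sub_obarK sub_obar_neq sub_ori_obar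
    sub_len_gt0 sub_len_obar sub_par_obar sub_par_inj sub_par_local_isometry
    sub_par_continuous sub_par0_vtx sub_par_component sub_par_surj sub_par_edge_inj.

Definition piece0 : oedge subdivide := inl e.
Definition piece1 : oedge subdivide := inr true.

Lemma src_piece0 : src piece0 = src e.
Proof. by rewrite /src /= /sub_par /= eq_sym obar_neqe addr0. Qed.

Lemma len_piece0 : len piece0 = t.
Proof. by rewrite /= eqxx. Qed.

Lemma len_piece1 : len piece1 = len e - t.
Proof. by []. Qed.

Lemma tgt_piece0 : tgt piece0 = par e t.
Proof. by rewrite /tgt /= /sub_par /= eq_sym obar_neqe eqxx add0r. Qed.

Lemma src_piece1 : src piece1 = par e t.
Proof. by rewrite /src /= /sub_par /= addr0. Qed.

Lemma tgt_piece1 : tgt piece1 = tgt e.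
Proof. by rewrite /tgt /= /sub_par /= addrC subrK. Qed.

Lemma src_subdivide (s : oedge subdivide) : src s = par e t -> s = piece1 \/ s = obar piece0.
Proof.
rewrite /src /= /sub_par addr0; case: s => [f|[]] /=; [|by left|].
  case: eqVneq => [->|_ fx]; first by right.
  by case: nvx; rewrite /x -fx; exact: src_vtx.
by move=> fx; case: nvx; rewrite /x -fx; exact: src_vtx.
Qed.

End subdivision.

(** * Variation of the measures along an edge *)

Section vertex_on_line.
Context {R : realType} {T : metricType R}.
Hypotheses (mT : metric_graph T) (sT : simply_connected T).
Context (o : ends T) (mu : T -> probability (borel o) R).
Hypothesis mu_end : forall x, end_measure x (mu x).
Context (G : model T) (e1 e2 : oedge G).
Hypotheses (e12 : tgt e1 = src e2) (ne12 : e2 <> obar e1)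
  (e12_only : forall f : oedge G, src f = src e2 -> f = e2 \/ f = obar e1).
Context (p1 p2 : oedge G -> R).
Hypotheses (p1P : harmonic_projection (de e1) p1) (p2P : harmonic_projection (de e2) p2).

Let l1 : 0 < len e1. Proof. exact: len_gt0. Qed.
Let l2 : 0 < len e2. Proof. exact: len_gt0. Qed.

(** Conservation of flow at a vertex whose only outgoing edges are [e2] and the reverse of [e1]. *)
Lemma harmonic_constant_on_line h : Defs.harmonic h -> coef h e1 = coef h e2.
Proof.
move=> hh; have ch := harmonic_C1 hh; have [_ /(_ _ (src_vtx e2))] := hh.
rewrite dstarE// => /eqP; rewrite oppr_eq0 => /eqP.
have -> : [set e | src e = src e2] = e2 |` [set obar e1].
  apply/seteqP; split=> [f /e12_only[->|->]|f [->|->]] //=; [by left|by right|].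
  by rewrite src_obar.
rewrite fsbigU0 ?fsbig_set1; [|exact: finite_set1|exact: finite_set1|]; last first.
  by move=> f [/= -> /ne12].
by rewrite coef_obar// => /subr0_eq.
Qed.

(* A harmonic form is constant along the line [e1 e2], so [de e1] and [de e2],
   scaled by the lengths, have the same projection. *)
Lemma projection_on_line f : (len e1)^-1 * coef p1 f = (len e2)^-1 * coef p2 f.
Proof.
have [h1 _] := p1P; have [h2 _] := p2P.
pose k := fun f => (len e1)^-1 * p1 f + (- (len e2)^-1) * p2 f.
have hk : Defs.harmonic k by exact: harmonic_lin.
have k0 : pairing k k = 0.
  rewrite {1}/k pairing_lin; [|exact: harmonic_L2..].
  rewrite (projection_pairing p1P hk) (projection_pairing p2P hk).
  rewrite (harmonic_constant_on_line hk).
  rewrite mulrCA mulVf ?gt_eqF// mulNr [X in _ - X]mulrCA mulVf ?gt_eqF//.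
  by rewrite subrr.
have := pairing_eq0 (harmonic_L2 hk) k0 f.
by rewrite /k coef_lin mulNr => /subr0_eq.
Qed.

(** By [projection_on_line] the mass of each branch has the same slope along [e1] and [e2], so its
    value at the middle vertex is the affine interpolation, each end being weighted by the length of
    the opposite edge. Both sides are finite measures of equal total mass, hence agree on Borel
    sets. *)
Lemma end_measure_on_line A : measurable A -> mu (src e2) A =
  ((len e2 / (len e1 + len e2))%:E * mu (src e1) A +
   (len e1 / (len e1 + len e2))%:E * mu (tgt e2) A)%E.
Proof.
have L0 : 0 < len e1 + len e2 by rewrite addr_gt0.
have a0 : 0 <= len e2 / (len e1 + len e2) by rewrite divr_ge0// ltW.
have b0 : 0 <= len e1 / (len e1 + len e2) by rewrite divr_ge0// ltW.
have ab1 : len e2 / (len e1 + len e2) + len e1 / (len e1 + len e2) = 1.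
  by rewrite -mulrDl addrC divff// gt_eqF.
move=> mA.
pose m := measure_add (mscale (NngNum a0) (mu (src e1))) (mscale (NngNum b0) (mu (tgt e2))).
have mE B : m B = ((len e2 / (len e1 + len e2))%:E * mu (src e1) B +
    (len e1 / (len e1 + len e2))%:E * mu (tgt e2) B)%E.
  by rewrite /m measure_addE.
rewrite -mE; apply: (eq_measure_branch_ends mT sT (x0 := src e2)) => //.
- exact: src_vtx.
- by rewrite ltey_eq fin_num_measure.
- have pT y : mu y setT = 1%E by exact: probability_setT.
  by rewrite [RHS]mE [LHS]pT !pT !mule1 -EFinD ab1.
move=> f nf; have ME y : mu y (branch_ends f) = (mass mu y f)%:E := massE mu y f.
rewrite [RHS]mE [LHS]ME !ME -!EFinM -EFinD; congr EFin.
have M1 := projection_mass mT sT mu_end f p1P; rewrite e12 in M1.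
have M2 := projection_mass mT sT mu_end f p2P.
have := projection_on_line f; rewrite -{}M1 -{}M2 => H.
have L0' : len e1 + len e2 != 0 by rewrite gt_eqF.
have l1' : len e1 != 0 by rewrite gt_eqF.
have l2' : len e2 != 0 by rewrite gt_eqF.
have {}H : len e2 * (mass mu (src e2) f - mass mu (src e1) f) =
    len e1 * (mass mu (tgt e2) f - mass mu (src e2) f).
  have -> : mass mu (src e2) f - mass mu (src e1) f =
      len e1 * ((len e1)^-1 * (mass mu (src e2) f - mass mu (src e1) f)).
    by rewrite mulVKf.
  by rewrite H mulrCA [X in _ * X]mulrA mulfV// mul1r.
have E a b : a / (len e1 + len e2) * b * (len e1 + len e2) = a * b.
  by rewrite [LHS]mulrAC divfK.
by apply: (mulIf L0'); rewrite mulrDl !E; lra.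
Qed.

End vertex_on_line.

Section edge_measures.
Context {R : realType} {T : metricType R}.
Hypotheses (mT : metric_graph T) (sT : simply_connected T).
Context (o : ends T) (mu : T -> probability (borel o) R).
Hypothesis mu_end : forall x, end_measure x (mu x).
Hypothesis projections : forall (G : model T) (e : oedge G),
  exists p, harmonic_projection (de e) p.
Context (G : model T) (e : oedge G).

Lemma end_measure_affine t A : 0 < t < len e -> measurable A -> mu (par e t) A =
  ((1 - t / len e)%:E * mu (src e) A + (t / len e)%:E * mu (tgt e) A)%E.
Proof.
move=> tl mA; have [p1 p1P] := projections (piece0 tl).
have [p2 p2P] := projections (piece1 tl).
have l0 : len e != 0 by rewrite gt_eqF// len_gt0.
have e12 : tgt (piece0 tl) = src (piece1 tl) by rewrite tgt_piece0 src_piece1.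
have only (f : oedge (subdivide tl)) : src f = src (piece1 tl) ->
    f = piece1 tl \/ f = obar (piece0 tl).
  by rewrite src_piece1; exact: src_subdivide.
have := end_measure_on_line mT sT mu_end e12 _ only p1P p2P mA.
move=> /(_ _)/wrap[//|].
rewrite src_piece1 src_piece0 tgt_piece1 len_piece0 len_piece1.
have -> : t + (len e - t) = len e by lra.
move=> ->; congr (_%:E * _ + _)%E.
by rewrite mulrBl divff.
Qed.

(** Affinity makes the difference quotient equal to its limit as soon as [t + h] stays inside the
    edge, so the convergence, in total variation, is that of an eventually zero function. *)
Lemma cvg_end_measure t : 0 < t < len e ->
  (fun h : R => charge_tv (cadd
     (cscale h^-1 (prob_diff (mu (par e (t + h))) (mu (par e t))))
     (copp (cscale (len e)^-1 (prob_diff (mu (tgt e)) (mu (src e))))))) @ 0^' --> 0%E.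
Proof.
move=> tl; apply: cvg_near_cst; rewrite /dnbhs near_withinE.
apply/nbhs_ballP; exists (Num.min t (len e - t)) => /=.
  by rewrite lt_min subr_gt0; case/andP: tl => -> ->.
move=> h; rewrite /ball /= sub0r normrN lt_min => /andP[ht hl] h0.
have thl : 0 < t + h < len e.
  by have := ler_norm h; have := ler_norm (- h); rewrite normrN; lra.
apply: charge_tv_eq0 => A mA.
transitivity (h^-1%:E * (mu (par e (t + h)) A - mu (par e t) A) +
  - ((len e)^-1%:E * (mu (tgt e) A - mu (src e) A)))%E => //.
rewrite (end_measure_affine thl mA) (end_measure_affine tl mA).
have fin x : mu x A = (fine (mu x A))%:E by rewrite fineK// fin_num_measure.
rewrite (fin (src e)) (fin (tgt e)); move: (fine _) (fine _) => b a.
transitivity (h^-1 * ((1 - (t + h) / len e) * a + (t + h) / len e * b -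
  ((1 - t / len e) * a + t / len e * b)) - (len e)^-1 * (b - a))%:E.
  exact: erefl.
congr EFin; field.
by rewrite h0 gt_eqF// len_gt0.
Qed.

End edge_measures.

(** The sets with measurable preimage form a sigma-algebra, which contains the open sets because
    [par e] is continuous on the open interval. The integral in (b) is taken over such a
    preimage. *)
Lemma measurable_par_preimage {R : realType} {T : metricType R} (G : model T)
    (e : oedge G) (o : T) (A : set (borel o)) : measurable A ->
  measurable (`]0, len e[ `&` par e @^-1` A : set (measurableTypeR R)).
Proof.
move=> mA; have mI : measurable (`]0, len e[%classic : set (measurableTypeR R)) by exact: measurable_itv.
pose Q := [set B : set (borel o) |
  measurable (`]0, len e[ `&` par e @^-1` B : set (measurableTypeR R))].
suff : <<s (@open T) >> `<=` Q by move/(_ _ mA).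
apply: smallest_sub.
  split.
  - by rewrite /Q /= preimage_set0 setI0; exact: measurable0.
  - move=> B QB; rewrite /Q /= setTD.
    rewrite (_ : _ `&` _ = `]0, len e[ `\` (`]0, len e[ `&` par e @^-1` B)).
      exact: measurableD.
    rewrite preimage_setC; apply/seteqP; split=> u /= [ul].
      by move=> nB; split => // -[].
    by move=> nB; split => // uB; apply: nB.
  - move=> F QF; rewrite /Q /= preimage_bigcup setI_bigcupr.
    by apply: bigcupT_measurable => n; exact: QF.
move=> U oU; apply: open_measurable.
have /continuous_inP : {in `]0, len e[%classic, continuous (par e)}.
  rewrite -continuous_open_subspace; last exact: interval_open.
  apply: continuous_subspaceW (@par_continuous _ _ _ e) => u /=.
  by rewrite !in_itv /=; lra.
by apply => //; exact: interval_open.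
Qed.

Theorem theoremE (R : realType) (T T' : metricType R) (phi : T' -> T) (g : nat)
    (p : T) (p' : T') (o : ends T')
    (mu_phi : {measure set (borel p) -> \bar R})
    (mu_can : {measure set (borel p') -> \bar R})
    (mu : T' -> probability (borel o) R) :
  metric_graph T -> compact [set: T] -> has_genus T g -> (2 <= g)%N ->
  universal_cover phi ->
  canonical_measure mu_can ->
  pushdown_measure phi mu_can mu_phi ->
  (forall x, end_measure x (mu x)) ->
  (forall (G : model T) (G' : model T') (e : oedge G) (e' : oedge G'),
     edge_lift phi e e' ->
     mu_phi (edge e) =
       (2^-1%:E * charge_tv (prob_diff (mu (tgt e')) (mu (src e'))))%E)
  /\
  (forall (G' : model T') (e' : oedge G'),
     exists D : R -> {charge set (borel o) -> \bar R},
       (forall t, 0 < t < len e' ->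
          (fun h : R => charge_tv (cadd
             (cscale h^-1 (prob_diff (mu (par e' (t + h))) (mu (par e' t))))
             (copp (D t)))) @ 0^' --> 0%E) /\
       (forall A : set (borel p'), measurable A -> A `<=` edge e' ->
          mu_can A =
            (\int[lebesgue_measure]_(t in `]0%R, len e'[ `&` par e' @^-1` A)
               (2^-1%:E * charge_tv (D t)))%E)).
Proof.
move=> _ _ _ _ [mT _ sT] can push mu_end.
(* Existence of projections is read off from the canonical measure, in every model, which covers the
   subdivided ones used for (b). *)
have projections (G : model T') (e : oedge G) : exists p, harmonic_projection (de e) p.
  by have [_ /(_ e)[_ [q qP _]]] := can G; exists q.
have half : 2^-1 * 2 = 1 :> R by rewrite mulVf.
split=> [G G' e e' ee'|G e].
  have [_ /(_ e)[_ /(_ G' e' ee') ->]] := push G.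
  have [_ /(_ e')[_ [q qP ->]]] := can G'.
  rewrite (prob_diff_tv mT sT mu_end (projections G') qP) -EFinM mulrA half mul1r.
  by [].
have l0 := len_gt0 e.
have [_ /(_ e)[[k k0 kE] [q qP qE]]] := can G.
exists (fun=> cscale (len e)^-1 (prob_diff (mu (tgt e)) (mu (src e)))); split.
  by move=> t; exact: cvg_end_measure.
move=> A mA Ae; rewrite kE//.
(* The constant density is identified by evaluating the canonical measure on the whole edge. *)
have qk : coef q e = k * len e.
  have mE : measurable (edge e : set (borel p')).
    by apply: sub_sigma_algebra; exact: edge_open.
  have := kE _ mE (@subset_refl _ _); rewrite qE setIidl; last first.
    by move=> t /= te; exists t.
  by rewrite lebesgue_measure_itv /= lte_fin l0 oppr0 adde0 -EFinM => -[].
have mS := measurable_par_preimage e mA.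
rewrite charge_tvZ ?invr_ge0 ?(ltW l0)// (prob_diff_tv mT sT mu_end (projections G) qP).
rewrite -!EFinM [RHS](integral_cst _ mS).
congr (_%:E * _)%E; rewrite qk; field.
by rewrite gt_eqF.
Qed.
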